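(* Let $N$ be a nilpotent operator on $\mathbb{C}^n$, with its associated Young diagram whose boxes are indexed by $1,\dots,n$, and let $e_1,\dots,e_n$ be a basis of $\mathbb{C}^n$ such that $Ne_k=e_j$ if box $k$ lies directly above box $j$, and $Ne_k=0$ if box $k$ has no box below it. Let $B\subset GL_n(\mathbb{C})$ be the subgroup of upper triangular matrices with respect to this basis, and let $H$ be a Hessenberg space with corresponding function $h$. The Hessenberg variety $\mathcal{H}(N,H)$ is paved by affines by the nonempty intersections $B\pi B\cap\mathcal{H}(N,H)$, $\pi\in S_n$. Associate to $\pi$ the filling of the Young diagram in which box $i$ contains $\pi^{-1}(i)$ for each $i$. Then the nonempty cells correspond exactly to those fillings such that, whenever box $k$ lies directly above box $j$, one has $\pi^{-1}(j)\le h(\pi^{-1}(k))$. Moreover, the dimension of the nonempty cell corresponding to $\pi$ is the sum of the following two quantities: (1) the number of pairs of boxes $(i,j)$ such that box $i$ is to the right of or below box $j$, there is no box above box $j$, and $\pi^{-1}(i)>\pi^{-1}(j)$; (2) the number of triples of boxes $(i,j,k)$ such that box $k$ lies directly above box $j$, box $i$ is to the right of or below box $j$, and $\pi^{-1}(j)<\pi^{-1}(i)\le h(\pi^{-1}(k))$.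
   Context: Young diagram of $N$: if the Jordan blocks of $N$ have sizes $\mu_1\ge\mu_2\ge\dots\ge\mu_s$, the diagram has $\mu_i$ boxes in its $i$-th column (from the left), and is left-aligned and bottom-aligned (all columns start at the bottom row). The boxes are indexed by $1,\dots,n$ starting from the rightmost box of the bottom row, incrementing leftwards along the row, then passing to the rightmost box of the next higher row, and so on. ''Box $i$ is to the right of or below box $j$'' means that box $i$ lies in a lower row than box $j$, or in the same row to its right; equivalently $i<j$. Let $\mathfrak{g}=\mathfrak{gl}_n(\mathbb{C})$, $G=GL_n(\mathbb{C})$, $\mathfrak{b}$ the Lie algebra of $B$, and $E_{ij}$ the matrix units with respect to $e_1,\dots,e_n$. A Hessenberg space is a subspace $H$ with $\mathfrak{b}\subseteq H\subseteq\mathfrak{g}$ and $[\mathfrak{b},H]\subseteq H$. Hessenberg spaces correspond bijectively to functions $h:\{1,\dots,n\}\to\{1,\dots,n\}$ with $h(i)\ge\max\{i,h(i-1)\}$ for all $i$, via: $E_{ij}\in H$ if and only if $i\le h(j)$ (and $H$ is spanned by these $E_{ij}$). The Hessenberg variety is $\mathcal{H}(N,H)=\{gB\in G/B: g^{-1}Ng\in H\}$. $\pi\in S_n$ is identified with the permutation matrix $\pi e_i=e_{\pi(i)}$, and $B\pi B$ also denotes the Schubert cell in $G/B$. A paving of a variety is an ordered partition $(\mathcal{P}_1,\mathcal{P}_2,\ldots)$ into disjoint subvarieties such that each finite union $\bigcup_{j\le i}\mathcal{P}_j$ is closed; it is a paving by affines if each $\mathcal{P}_i$ is isomorphic to an affine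 space. *)

(* Defs.v *)
From HB Require Import structures.
From mathcomp Require Import all_boot all_order all_algebra all_fingroup.
From mathcomp Require Import classical_sets reals.
From mathcomp Require Import complex.
From mathcomp Require Import mpoly.

Set Implicit Arguments.
Unset Strict Implicit.
Unset Printing Implicit Defensive.

Import GRing.Theory.
Local Open Scope ring_scope.
Local Open Scope classical_set_scope.

(* Indices are 0-based: 'I_n stands for {1, ..., n}. *)

(** * Varieties as spaces with functions *)

(* A reduced variety over K is described by its Zariski topology and its sheaf
   of K-valued regular functions.  [zregular U f] is meant for open U and says
   that the restriction of f to U is regular: the values of f outside U are
   irrelevant. *)
Record kspace (K : fieldType) := KSpace {
  points :> Type;
  zopen : set (set points);
  zregular : set points -> set (points -> K)
}.

Arguments zopen {K k}.
Arguments zregular {K k}.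

Section Spaces.
Variable K : fieldType.

(* T identified with K^d by the coordinates x. *)
Definition coord_space (T : Type) (d : nat) (x : T -> 'rV[K]_d) : kspace K := {|
  points := T;
  zopen := [set U : set T | exists S : set {mpoly K[d]},
    ~` U = [set t | forall p, S p -> p.@[x t ord0] = 0]];
  zregular := fun U => [set f : T -> K | forall t, U t ->
    exists p q : {mpoly K[d]}, q.@[x t ord0] != 0 /\
      forall u, U u -> q.@[x u ord0] != 0 ->
        f u = p.@[x u ord0] / q.@[x u ord0]]
|}.

Definition affine_space (d : nat) : kspace K := coord_space (@id 'rV[K]_d).

Definition matrix_space (m n : nat) : kspace K := coord_space (@mxvec K m n).

(* Induced reduced structure on a subset; the cases of interest are the
   locally closed subsets. *)
Definition induced_space (X : kspace K) (A : set X) : kspace K := {|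
  points := set_type A;
  zopen := [set U | exists2 V : set X, zopen V & U = val @^-1` V];
  zregular := fun U => [set f : set_type A -> K | forall x, U x ->
    exists (V : set X) (F : X -> K), [/\ zopen V, zregular V F, V (val x) &
      forall y, U y -> V (val y) -> f y = F (val y)]]
|}.

Definition quotient_space (X : kspace K) (Y : Type) (q : X -> Y) : kspace K := {|
  points := Y;
  zopen := [set U | zopen (q @^-1` U)];
  zregular := fun U => [set f : Y -> K | zregular (q @^-1` U) (f \o q)]
|}.

Definition isomorphic (X Y : kspace K) : Prop :=
  exists phi : X -> Y, [/\ bijective phi,
    forall U : set Y, zopen U <-> zopen (phi @^-1` U) &
    forall (U : set Y) (f : Y -> K), zopen U ->
      (zregular U f <-> zregular (phi @^-1` U) (f \o phi))].

Definition zclosed (X : kspace K) (A : set X) : Prop := zopen (~` A).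

Definition locally_closed (X : kspace K) (A : set X) : Prop :=
  exists U C : set X, [/\ zopen U, zclosed C & A = U `&` C].

Definition irreducible (X : kspace K) (A : set X) : Prop :=
  A !=set0 /\ forall C D : set X, zclosed C -> zclosed D ->
    A `<=` C `|` D -> A `<=` C \/ A `<=` D.

Definition irreducible_chain (X : kspace K) (m : nat) (Z : nat -> set X) :=
  (forall i, (i <= m)%N -> zclosed (Z i) /\ irreducible (Z i)) /\
  (forall i, (i < m)%N -> Z i `<=` Z i.+1 /\ Z i <> Z i.+1).

(* Krull dimension of the underlying topological space. *)
Definition has_dimension (X : kspace K) (d : nat) : Prop :=
  (exists Z : nat -> set X, irreducible_chain d Z) /\
  (forall m (Z : nat -> set X), irreducible_chain m Z -> (m <= d)%N).

Definition paving (X : kspace K) (P : seq (set X)) : Prop :=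
  [/\ forall x : X, exists2 i, (i < size P)%N & nth set0 P i x,
      forall i j, (i < j < size P)%N -> nth set0 P i `&` nth set0 P j = set0,
      forall i, (i < size P)%N -> locally_closed (nth set0 P i) &
      forall i, (i <= size P)%N -> zclosed (\bigcup_(k < i) nth set0 P k)].

Definition paving_by_affines (X : kspace K) (P : seq (set X)) : Prop :=
  paving P /\ forall i, (i < size P)%N ->
    exists d, isomorphic (affine_space d) (induced_space (nth set0 P i)).

End Spaces.

(** * The flag variety and Hessenberg varieties *)

Section Flags.
Variables (K : fieldType) (n : nat).

Definition upper_triangular (A : 'M[K]_n) : bool := is_trig_mx A^T.

Definition GL : kspace K :=
  induced_space [set A : matrix_space K n n | (A : 'M[K]_n) \in unitmx].

Definition GLmx (g : GL) : 'M[K]_n := val g.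

Definition Borel : set GL := [set b | upper_triangular (GLmx b)].

Definition Borel_coset (g : GL) : set GL :=
  [set g' | exists2 b, Borel b & GLmx g' = GLmx g *m GLmx b].

Definition to_flag (g : GL) : set_type (range Borel_coset) :=
  exist _ (Borel_coset g) (mem_set (imageT Borel_coset g)).

(* G/B; regular functions on an open U are the right B-invariant regular
   functions on the preimage of U in G. *)
Definition flag_variety : kspace K := quotient_space to_flag.

(* The matrix with pi e_i = e_(pi i).  The library's perm_mx pi is its
   transpose. *)
Definition permutation_matrix (pi : 'S_n) : 'M[K]_n :=
  \matrix_(i, j) (i == pi j)%:R.

Definition schubert_cell (pi : 'S_n) : set flag_variety :=
  [set to_flag g | g in [set g | exists b1 b2, [/\ Borel b1, Borel b2 &
     GLmx g = GLmx b1 *m permutation_matrix pi *m GLmx b2]]].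

Definition hessenberg_space (H : {vspace 'M[K]_n}) : Prop :=
  (forall b, upper_triangular b -> b \in H) /\
  (forall b A, upper_triangular b -> A \in H -> b *m A - A *m b \in H).

Definition hessenberg_function (h : 'I_n -> 'I_n) : Prop :=
  (forall i : 'I_n, (i <= h i)%N) /\
  (forall i j : 'I_n, j = i.+1 :> nat -> (h i <= h j)%N).

Definition corresponding_function (H : {vspace 'M[K]_n}) (h : 'I_n -> 'I_n) :=
  hessenberg_function h /\
  forall i j : 'I_n, (delta_mx i j \in H) = (i <= h j)%N.

Definition hessenberg_set (N : 'M[K]_n) (H : {vspace 'M[K]_n}) :
    set flag_variety :=
  [set to_flag g | g in [set g | invmx (GLmx g) *m N *m GLmx g \in H]].

Definition hessenberg_variety (N : 'M[K]_n) (H : {vspace 'M[K]_n}) : kspace K :=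
  induced_space (hessenberg_set N H).

Definition hessenberg_cell (N : 'M[K]_n) (H : {vspace 'M[K]_n}) (pi : 'S_n) :
    set (hessenberg_variety N H) :=
  val @^-1` schubert_cell pi.

End Flags.

Arguments hessenberg_cell {K n} N H pi.

(** * Jordan type and Young diagrams *)

Definition is_partition (mu : seq nat) : bool :=
  sorted geq mu && (0%N \notin mu).

Definition jordan_block (K : fieldType) (m : nat) : 'M[K]_m :=
  \matrix_(i, j) (i.+1 == j :> nat)%:R.

(* N is nilpotent with Jordan blocks of sizes mu.  The two inverse conditions
   on P and Q force sumn mu = n. *)
Definition jordan_type (K : fieldType) (n : nat) (N : 'M[K]_n) (mu : seq nat) :=
  exists (P : 'M[K]_(n, \sum_(i < size mu) nth 0%N mu i))
         (Q : 'M[K]_(\sum_(i < size mu) nth 0%N mu i, n)),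
    [/\ P *m Q = 1%:M, Q *m P = 1%:M &
        Q *m N *m P =
          \mxdiag_(i < size mu) @jordan_block K (nth 0%N mu i)].

(* The diagram with mu_c boxes in column c.  A box is a pair (row, column),
   with row 0 at the bottom and column 0 at the left; the boxes are listed in
   the order in which they are indexed: rows from bottom to top, and each row
   from right to left. *)
Definition row_length (mu : seq nat) (r : nat) : nat :=
  count (fun m => r < m)%N mu.

Definition boxes (mu : seq nat) : seq (nat * nat) :=
  [seq (r, c) | r <- iota 0 (head 0%N mu), c <- rev (iota 0 (row_length mu r))].

Definition box (mu : seq nat) (i : nat) : nat * nat :=
  nth (0%N, 0%N) (boxes mu) i.

Definition directly_above (mu : seq nat) (k j : nat) : bool :=
  ((box mu k).1 == (box mu j).1.+1) && ((box mu k).2 == (box mu j).2).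

Definition right_or_below (mu : seq nat) (i j : nat) : bool :=
  ((box mu i).1 < (box mu j).1)%N ||
  (((box mu i).1 == (box mu j).1) && ((box mu j).2 < (box mu i).2)%N).

(* The columns of e form a basis on which N acts by moving one box down. *)
Definition young_basis (K : fieldType) (n : nat) (N : 'M[K]_n) (mu : seq nat)
    (e : 'M[K]_n) : Prop :=
  [/\ e \in unitmx,
      forall k j : 'I_n, directly_above mu k j -> N *m col k e = col j e &
      forall k : 'I_n, (forall j : 'I_n, ~~ directly_above mu k j) ->
        N *m col k e = 0].

(* The matrix of N (acting on column vectors) in the basis of columns of e. *)
Definition matrix_in_basis (K : fieldType) (n : nat) (e N : 'M[K]_n) :
    'M[K]_n :=
  invmx e *m N *m e.

(* Box i contains pi^-1 i. *)
Definition filling (n : nat) (pi : 'S_n) (i : 'I_n) : 'I_n := (pi^-1)%g i.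

Definition admissible (n : nat) (mu : seq nat) (h : 'I_n -> 'I_n)
    (pi : 'S_n) : Prop :=
  forall k j : 'I_n, directly_above mu k j ->
    (filling pi j <= h (filling pi k))%N.

Definition top_inversions (n : nat) (mu : seq nat) (pi : 'S_n) :
    {set 'I_n * 'I_n} :=
  [set p : 'I_n * 'I_n | [&& right_or_below mu p.1 p.2,
     [forall k : 'I_n, ~~ directly_above mu k p.2] &
     (filling pi p.2 < filling pi p.1)%N]]%SET.

Definition hessenberg_triples (n : nat) (mu : seq nat) (h : 'I_n -> 'I_n)
    (pi : 'S_n) : {set 'I_n * 'I_n * 'I_n} :=
  [set t : 'I_n * 'I_n * 'I_n | let: (i, j, k) := t in
     [&& directly_above mu k j, right_or_below mu i j &
         (filling pi j < filling pi i <= h (filling pi k))%N]]%SET.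

(* Main.v *)
Require Import Defs.
From mathcomp Require Import all_boot all_order all_algebra all_fingroup.
From mathcomp Require Import classical_sets reals complex.
From mathcomp Require Import boolp mpoly zify ring.

(** Write tau for the inverse of pi.  Each flag of B pi B is u pi B for a unique
    unipotent upper triangular u whose nonzero entries (i, j) off the diagonal
    satisfy tau j < tau i.  It lies in the Hessenberg variety iff the matrix c with
    N u = u c has c_ik = 0 whenever tau i > h (tau k).  Going through the rows from
    bottom to top and through each row from left to right, the equations c_ik = 0
    with k above j express u_ij polynomially in earlier entries when
    tau i > h (tau k), the other u_ij are free, and the remaining equations hold
    identically when the filling is admissible.  So the intersection is the graph of
    a polynomial map; the inverse of its parametrization is regular because the
    entries of u are ratios of minors of pi^-1 g.

    The chart pi U^- B (U^- the lower unipotent matrices), where the leading minors of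
    pi^-1 g do not vanish, contains the cell of pi and otherwise meets only cells of
    sigma with larger sums pi 0 + ... + pi m; this orders the cells.

    An affine space of dimension d has Krull dimension d: along a strict chain
    Z_0, ..., Z_m of irreducible closed sets one constructs about t^m polynomials of
    degree O(t) that are linearly independent on Z_m, which forces m <= d. *)

Set Implicit Arguments.
Unset Strict Implicit.
Unset Printing Implicit Defensive.

Import GRing.Theory Num.Theory.
Local Open Scope ring_scope.
Local Open Scope classical_set_scope.

(** * Dimension of affine space *)

Section CoordinateSpaces.
Variable K : fieldType.

Definition zero_set (T : Type) (d : nat) (x : T -> 'rV[K]_d)
    (S : set {mpoly K[d]}) : set T :=
  [set t | forall p, S p -> p.@[x t ord0] = 0].

Lemma zopen_coordP (T : Type) (d : nat) (x : T -> 'rV[K]_d)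
    (U : set (coord_space x)) :
  zopen U <-> exists S : set {mpoly K[d]},
    U = [set t | exists2 p, S p & p.@[x t ord0] != 0].
Proof.
split=> -[S hS]; exists S.
  rewrite -[U]setCK hS; apply/seteqP; split=> t /=.
    move=> /existsNP[p /not_implyP[Sp /eqP pt]]; by exists p.
  by move=> [p Sp pt] hp; rewrite hp ?eqxx in pt.
rewrite hS; apply/seteqP; split=> t /=.
  by move=> ht p Sp; apply/eqP/negPn/negP=> pt; apply: ht; exists p.
by move=> ht [p Sp]; rewrite ht ?eqxx.
Qed.

Lemma zclosed_coordP (T : Type) (d : nat) (x : T -> 'rV[K]_d)
    (C : set (coord_space x)) :
  zclosed C <-> exists S, C = zero_set x S.
Proof. by rewrite /zclosed /zopen /= setCK. Qed.

Lemma zclosed_zero_set (T : Type) (d : nat) (x : T -> 'rV[K]_d)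
    (S : set {mpoly K[d]}) : @zclosed K (coord_space x) (zero_set x S).
Proof. by apply/zclosed_coordP; exists S. Qed.

End CoordinateSpaces.

Section Dimension.
Variable K : numFieldType.

Lemma meval_sum_scale (d : nat) (I : finType) (a : I -> K)
    (f : I -> {mpoly K[d]}) v :
  (\sum_i a i *: f i).@[v] = \sum_i a i * (f i).@[v].
Proof. by rewrite raddf_sum; apply: eq_bigr => i _; rewrite /= mevalZ. Qed.

(* Two nonempty open subsets of a segment-closed set meet: restricted to a
   line, the product of two polynomials has finitely many zeros. *)
Lemma irreducible_line_closed (d : nat) (L : set (affine_space K d)) :
  L !=set0 ->
  (forall (a b : 'rV[K]_d) s, L a -> L b -> L (a + s *: (b - a))) ->
  irreducible L.
Proof.
move=> L0 Lline; split=> // C D /zclosed_coordP[S ->] /zclosed_coordP[S' ->] LCD.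
apply: contrapT => /not_orP[nC nD].
have /existsNP[a /not_implyP[La /existsNP[p /not_implyP[Sp /eqP pa]]]] := nC.
have /existsNP[b /not_implyP[Lb /existsNP[q /not_implyP[Sq /eqP qb]]]] := nD.
pose line (r : {mpoly K[d]}) : {poly K} :=
  mmap (@polyC K) (fun i => (a ord0 i)%:P + (b ord0 i - a ord0 i)%:P * 'X) r.
have lineE r s : (line r).[s] = r.@[(a + s *: (b - a)) ord0].
  rewrite /line /mmap mevalE horner_sum; apply: eq_bigr => m _.
  rewrite hornerM hornerC /mmap1 horner_prod; congr (_ * _).
  apply: eq_bigr => i _; rewrite hornerE; congr (_ ^+ _).
  by rewrite !hornerE !mxE mulrC.
have lp : line p != 0.
  apply/eqP => lp0; have := lineE p 0; rewrite lp0 horner0 scale0r addr0.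
  by move=> /esym/eqP; rewrite (negbTE pa).
have lq : line q != 0.
  apply/eqP => lq0; have := lineE q 1; rewrite lq0 horner0 scale1r addrC subrK.
  by move=> /esym/eqP; rewrite (negbTE qb).
have lpq : line p * line q != 0 by rewrite mulf_neq0.
(* A nonzero polynomial of size s has fewer than s roots, but the parameters 0, ..., s - 1, distinct
   in characteristic 0, would all be roots of the product. *)
have : (size [seq (i%:R : K) | i <- iota 0 (size (line p * line q)%R)]
         < size (line p * line q)%R)%N.
  apply: max_poly_roots => //; last first.
    by rewrite map_inj_uniq ?iota_uniq // => i j /eqP; rewrite eqr_nat => /eqP.
  apply/allP => s _; rewrite rootE hornerM !lineE mulf_eq0.
  by case: (LCD _ (Lline a b s La Lb)) => h; rewrite ?(h p Sp) ?(h q Sq) eqxx ?orbT.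
by rewrite size_map size_iota ltnn.
Qed.

Definition coordinate_subspace (d i : nat) : set (affine_space K d) :=
  [set v : 'rV[K]_d | forall j : 'I_d, (i <= j)%N -> v ord0 j = 0].

Lemma coordinate_chain (d : nat) :
  irreducible_chain d (@coordinate_subspace d).
Proof.
split=> i lid.
  split.
    apply/zclosed_coordP; exists [set 'X_j | j in [set j : 'I_d | (i <= j)%N]].
    apply/seteqP; split=> v /=.
      by move=> hv p [j ij <-]; rewrite mevalXU hv.
    by move=> hv j ij; rewrite -(hv 'X_j) ?mevalXU //; exists j.
  apply: irreducible_line_closed; first by exists 0 => j _; rewrite mxE.
  by move=> a b s ha hb j ij; rewrite !mxE ha // hb // subrr mulr0 addr0.
split=> [v hv j ij|/seteqP[_ /(_ (delta_mx ord0 (Ordinal lid)))]].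
  by apply: hv; apply: ltnW.
have h : coordinate_subspace i.+1 (delta_mx ord0 (Ordinal lid)).
  move=> j ij; rewrite mxE eqxx /=; case: eqP => // jE.
  by move: ij; rewrite jE /= ltnn.
move=> /(_ h (Ordinal lid) (leqnn _)); rewrite mxE !eqxx /=.
by move/eqP; rewrite oner_eq0.
Qed.

Definition independent_on (d : nat) (Z : set (affine_space K d)) (I : finType)
    (f : I -> {mpoly K[d]}) : Prop :=
  forall a : I -> K,
    (forall z : 'rV[K]_d, Z z -> \sum_i a i * (f i).@[z ord0] = 0) ->
    forall i, a i = 0.

(** Polynomials of degree at most D involve only the [D.+1 ^ d] monomials with all exponents at most
    D. With more polynomials than that, the coefficient matrix has a nonzero left kernel, and a
    linear relation between polynomials holds on every Z. *)
Lemma independent_bound (d D : nat) (Z : set (affine_space K d)) (I : finType)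
    (f : I -> {mpoly K[d]}) :
  independent_on Z f -> (forall i, (msize (f i) <= D.+1)%N) ->
  (#|I| <= D.+1 ^ d)%N.
Proof.
move=> find fsz; rewrite leqNgt; apply/negP => ltDI.
pose J := {ffun 'I_d -> 'I_D.+1}.
pose mon (g : J) : 'X_{1..d} := [multinom (g j : nat) | j < d].
pose A : 'M[K]_(#|I|, #|J|) := \matrix_(i, j) (f (enum_val i))@_(mon (enum_val j)).
have /rowV0Pn[v vA v0] : kermx A != 0.
  rewrite -mxrank_eq0 mxrank_ker -lt0n subn_gt0.
  by apply: (leq_ltn_trans (rank_leq_col _)); rewrite card_ffun !card_ord.
have vA0 : v *m A = 0 by apply/sub_kermxP.
pose a i := v ord0 (enum_rank i).
have a0 : \sum_i a i *: f i = 0.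
  apply/mpolyP => m; rewrite mcoeff0 raddf_sum /=.
  have [mD|] := boolP [forall j, m j < D.+1]%N.
    pose g : J := [ffun j => Ordinal (forallP mD j)].
    have gm : mon g = m by apply/mnmP => j; rewrite mnmE ffunE.
    have := congr1 (fun B : 'rV_ _ => B ord0 (enum_rank g)) vA0.
    rewrite !mxE => vg; rewrite -[RHS]vg (reindex (@enum_val I I)) /=; last first.
      by apply: onW_bij; exact: enum_val_bij.
    apply: eq_bigr => i _.
    by rewrite mcoeffZ mxE enum_rankK gm /a enum_valK.
  rewrite negb_forall => /existsP[j]; rewrite -leqNgt => mj.
  apply: big1 => i _; rewrite mcoeffZ [X in _ * X](_ : _ = 0) ?mulr0 //.
  apply/eqP; rewrite mcoeff_eq0; apply: msize_mdeg_ge; apply: leq_trans (fsz i) _.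
  by apply: leq_trans mj _; rewrite mdegE (bigD1 j) //= leq_addr.
case/negP: v0; apply/eqP/rowP => i; rewrite mxE; rewrite -(enum_valK i).
apply: (find a) => z Zz.
by rewrite -meval_sum_scale a0 meval0.
Qed.

Lemma msizeM_pred_le (d : nat) (p q : {mpoly K[d]}) :
  (msize (p * q) <= (msize p + msize q).-1)%N.
Proof.
have [->|p0] := eqVneq p 0; first by rewrite mul0r msize0.
have [->|q0] := eqVneq q 0; first by rewrite mulr0 msize0.
by rewrite msizeM.
Qed.

Lemma msize_exp_le (d s j : nat) (p : {mpoly K[d]}) :
  (msize p <= s.+1)%N -> (msize (p ^+ j) <= (s * j).+1)%N.
Proof.
move=> ps; elim: j => [|j IHj]; first by rewrite expr0 msize1.
rewrite exprS mulnS; have := msizeM_pred_le p (p ^+ j); lia.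
Qed.

(* In a relation on W, cancel the lowest power of F (W is irreducible) and restrict
   to Z: the coefficients of that power vanish. *)
Lemma independent_powers (d t : nat) (Z W : set (affine_space K d))
    (F : {mpoly K[d]}) (I : finType) (f : I -> {mpoly K[d]}) :
  irreducible W -> Z `<=` W ->
  (forall z : 'rV[K]_d, Z z -> F.@[z ord0] = 0) ->
  ~ (forall w : 'rV[K]_d, W w -> F.@[w ord0] = 0) ->
  independent_on Z f ->
  independent_on W (fun ij : 'I_t * I => F ^+ ij.1 * f ij.2).
Proof.
move=> [_ Wirr] ZW FZ FW find a ha [j i] /=.
elim/ltn_ind: {j}(j : nat) {-2}j (erefl (nat_of_ord j)) i => m IH j jm i.
pose q (l : 'I_t) := \sum_i a (l, i) *: f i.
pose G := \sum_(l < t | (j <= l)%N) F ^+ (l - j) * q l.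
have FG (w : 'rV[K]_d) : W w -> (F ^+ j * G).@[w ord0] = 0.
  move=> /ha <-; rewrite mulr_sumr raddf_sum /=.
  transitivity (\sum_l \sum_i a (l, i) * (F ^+ l * f i).@[w ord0]); last first.
    by rewrite pair_bigA /=; apply: eq_bigr => -[].
  rewrite [RHS](bigID (fun l : 'I_t => (j <= l)%N)) /= [X in _ = _ + X]big1.
    rewrite addr0; apply: eq_bigr => l jl.
    rewrite mulrA -exprD subnKC // mulr_sumr raddf_sum /=.
    apply: eq_bigr => i' _.
    by rewrite -scalerAr mevalZ.
  move=> l; rewrite -ltnNge => lj; apply: big1 => i' _.
  by rewrite (IH l) ?mul0r // -jm.
have GW w : W w -> G.@[w ord0] = 0.
  have WFG : W `<=` zero_set id [set F] `|` zero_set id [set G].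
    move=> v /FG; rewrite mevalM rmorphXn => /eqP.
    rewrite mulf_eq0 expf_eq0 => /orP[/andP[_ /eqP h]|/eqP h];
      by [left => _ -> | right => _ ->].
  case: (Wirr _ _ (zclosed_zero_set _ _) (zclosed_zero_set _ _) WFG) => h.
    by case: FW => v /h; apply.
  by move=> /h; apply.
apply: (find (fun i => a (j, i))) => z Zz.
rewrite -meval_sum_scale -/(q j); have := GW z (ZW _ Zz); rewrite /G (bigD1 j) //=.
rewrite mevalD subnn expr0 mul1r [X in _ + X]raddf_sum.
rewrite [X in _ + X]big1 ?addr0 //= => l /andP[jl lj].
have : (0 < l - j)%N by rewrite subn_gt0 ltn_neqAle jl eq_sym lj.
by case: (l - j)%N => // e _; rewrite exprS !mevalM FZ // !mul0r.
Qed.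

(** One step up the chain multiplies the family by the powers of exponent below t of an F that
    vanishes on [Z k] but not on [Z k.+1]. The size of the family grows by a factor t while the
    degrees stay linear in t, with a slope [e] chosen before t. *)
Lemma chain_independent (d m : nat) (Z : nat -> set (affine_space K d)) :
  irreducible_chain m Z -> forall k, (k <= m)%N ->
  exists e, forall t, exists (I : finType) (f : I -> {mpoly K[d]}),
    [/\ #|I| = (t ^ k)%N, forall i, (msize (f i) <= (e * t).+1)%N &
        independent_on (Z k) f].
Proof.
move=> [Zirr Zlt]; elim=> [|k IHk] km.
  exists 0%N => t; exists unit, (fun=> 1); split=> [|i|a ha [] ].
  - by rewrite card_unit.
  - by rewrite msize1.
  - have [_ [[z Zz] _]] := Zirr _ km.
    by have := ha _ Zz; rewrite (big_pred1 tt) => [|[]//]; rewrite meval1 mulr1.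
have {IHk}[e IHk] := IHk (ltnW km).
have [/zclosed_coordP[S ZS] _] := Zirr k (ltnW km).
have [_ Wirr] := Zirr k.+1 km.
have [ZW ZneW] := Zlt k km.
have [F FZ FW] : exists2 F : {mpoly K[d]},
    forall z : 'rV[K]_d, Z k z -> F.@[z ord0] = 0 &
    ~ (forall w : 'rV[K]_d, Z k.+1 w -> F.@[w ord0] = 0).
  apply: contrapT => nF; apply: ZneW; apply/seteqP; split=> // w Ww.
  rewrite ZS => p Sp; apply: contrapT => pw.
  apply: nF; exists p => [z|h]; last by apply: pw; apply: h.
  by rewrite ZS => /(_ _ Sp).
(* Each power [F ^+ j] with j < t has degree at most [msize F * t]. *)
exists (e + msize F)%N => t; have [I [f [cI fsz find]]] := IHk t.
exists ('I_t * I)%type, (fun ij : 'I_t * I => F ^+ ij.1 * f ij.2); split.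
- by rewrite card_prod card_ord cI expnS.
- move=> [j i] /=; have := msizeM_pred_le (F ^+ j) (f i).
  have := @msize_exp_le d (msize F) j F (leqnSn _); have := fsz i.
  have : (msize F * j <= msize F * t)%N by rewrite leq_mul // ltnW.
  by rewrite mulnDl; lia.
- exact: independent_powers Wirr ZW FZ FW find.
Qed.

Lemma dimension_affine_space (d : nat) : has_dimension (affine_space K d) d.
Proof.
split; first by exists (@coordinate_subspace d); apply: coordinate_chain.
move=> m Z hZ; rewrite leqNgt; apply/negP => dm.
have [e he] := chain_independent hZ (leqnn m).
(* With t larger than (e + 1)^d one gets (e t + 1)^d <= (e + 1)^d t^d < t^(d + 1) <= t^m, against
   [independent_bound]. *)
pose t := (e.+1 ^ d).+1.
have [I [f [cI fsz find]]] := he t.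
have := independent_bound find fsz; rewrite cI leqNgt => /negP; apply.
apply: (@leq_ltn_trans ((e.+1 * t) ^ d)).
  by case: (d) => // d'; rewrite leq_exp2r // mulSn addnC -addn1 leq_add.
rewrite expnMn; apply: (@leq_trans (t * t ^ d)).
  by rewrite ltn_pmul2r // expn_gt0.
by rewrite -expnS leq_pexp2l.
Qed.

Definition homeomorphism (X Y : kspace K) (g : X -> Y) : Prop :=
  bijective g /\ forall U : set Y, zopen U <-> zopen (g @^-1` U).

Lemma homeomorphism_inverse (X Y : kspace K) (g : X -> Y) :
  homeomorphism g -> exists g' : Y -> X, homeomorphism g'.
Proof.
move=> [[g' gK g'K] gopen]; exists g'; split; first by exists g.
move=> U; split=> [oU|/gopen].
  by apply/gopen; rewrite -comp_preimage; congr (zopen _): oU;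
    apply/seteqP; split=> x; rewrite /= gK.
by congr (zopen _); apply/seteqP; split=> x; rewrite /= gK.
Qed.

Lemma irreducible_chain_preimage (X Y : kspace K) (g : X -> Y) m Z :
  homeomorphism g -> irreducible_chain m Z ->
  irreducible_chain m (fun i => g @^-1` (Z i)).
Proof.
move=> [[g' gK g'K] gopen] [Zirr Zlt]; split=> i im.
  have [Zc [[y Zy] Zi]] := Zirr i im; split.
    by rewrite /zclosed preimage_setC -gopen.
  split; first by exists (g' y); rewrite /= g'K.
  have gc (C : set X) : zclosed C -> zclosed (g' @^-1` C).
    rewrite /zclosed preimage_setC => oC; apply/gopen.
    by congr (zopen _): oC; apply/seteqP; split=> x; rewrite /= gK.
  move=> C D /gc Cc /gc Dc CD.
  have /(Zi _ _ Cc Dc)[h|h] : Z i `<=` g' @^-1` C `|` g' @^-1` D.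
  - by move=> z Zz; apply: CD; rewrite /= g'K.
  - by left=> x /h; rewrite /= gK.
  - by right=> x /h; rewrite /= gK.
have [le ne] := Zlt i im; split=> [x /le //|/seteqP[_ h]].
by apply: ne; apply/seteqP; split=> // y Zy; have := h (g' y); rewrite /= g'K; apply.
Qed.

Lemma has_dimension_isomorphic (X Y : kspace K) (d : nat) :
  isomorphic X Y -> has_dimension X d -> has_dimension Y d.
Proof.
move=> [g [gbij gopen _]] [[Z hZ] dX].
have gh : homeomorphism g by [].
have [g' g'h] := homeomorphism_inverse gh; split.
  by exists (fun i => g' @^-1` (Z i)); apply: irreducible_chain_preimage.
move=> m W hW; apply: dX (fun i => g @^-1` (W i)) _.
exact: irreducible_chain_preimage.
Qed.

End Dimension.

(** * Minors and column echelon form *)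

Section UpperTriangular.
Variables (K : fieldType) (n : nat).
Implicit Types b : 'M[K]_n.

Lemma upper_triangularP b :
  reflect (forall i j : 'I_n, (j < i)%N -> b i j = 0) (upper_triangular b).
Proof.
apply: (iffP is_trig_mxP) => h i j ij; have := h j i ij; by rewrite mxE.
Qed.

Lemma upper_triangular1 : upper_triangular (1%:M : 'M[K]_n).
Proof. by apply/upper_triangularP => i j ij; rewrite mxE -val_eqE gtn_eqF. Qed.

Lemma upper_triangularM b b' :
  upper_triangular b -> upper_triangular b' -> upper_triangular (b *m b').
Proof.
move=> /upper_triangularP hb /upper_triangularP hb'.
apply/upper_triangularP => i j ij; rewrite mxE big1 // => k _.
have [ik|ki] := leqP i k; first by rewrite hb' ?mulr0 //; apply: leq_trans ik.
by rewrite hb ?mul0r.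
Qed.

Lemma det_upper_triangular b : upper_triangular b -> \det b = \prod_i b i i.
Proof.
move=> hb; rewrite -det_tr det_trig //.
by apply: eq_bigr => i _; rewrite mxE.
Qed.

Lemma upper_triangular_unitmx b : upper_triangular b ->
  b \in unitmx = [forall i, b i i != 0].
Proof.
move=> hb; rewrite unitmxE unitfE det_upper_triangular // prodf_seq_neq0.
apply/allP/forallP => [h i|h i _]; last exact: h.
by apply: h; rewrite mem_index_enum.
Qed.

(** Induction on rows from the last one upwards: below the diagonal, entry (i, j) of the product of
    [b] with its inverse reduces to [b i i * invmx b i j]. *)
Lemma upper_triangular_inv b :
  b \in unitmx -> upper_triangular b -> upper_triangular (invmx b).
Proof.
move=> ub hb; have /upper_triangularP hb' := hb.
have /forallP b0 : [forall i, b i i != 0] by rewrite -upper_triangular_unitmx.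
have h m (i j : 'I_n) : (n - i <= m)%N -> (j < i)%N -> invmx b i j = 0.
  elim: m i => [|m IHm] i im ji; first by have := ltn_ord i; lia.
  have := congr1 (fun A : 'M_n => A i j) (mulmxV ub).
  rewrite !mxE -val_eqE (gtn_eqF ji) (bigD1 i) //= big1 ?addr0 => [/eqP|k ki].
    by rewrite mulf_eq0 (negbTE (b0 i)) => /eqP.
  have [ik|ik] := ltnP i k; last by rewrite hb' ?mul0r // ltn_neqAle ki.
  rewrite IHm ?mulr0 //; last exact: ltn_trans ik.
  by have := ltn_ord k; lia.
by apply/upper_triangularP => i j ji; apply: h ji.
Qed.

End UpperTriangular.

Section Minors.
Variables (A : comNzRingType) (n : nat).

Definition minor_row (a b : 'I_n) (r : 'I_b.+1) : 'I_n :=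
  if (r < b)%N then widen_ord (ltn_ord b) r else a.

(* Rows 0, ..., b - 1, a and columns 0, ..., b. *)
Definition minor (a b : 'I_n) (M : 'M[A]_n) : A :=
  \det (mxsub (@minor_row a b) (widen_ord (ltn_ord b)) M).

Lemma minor_row_diag (b : 'I_n) : @minor_row b b =1 widen_ord (ltn_ord b).
Proof.
move=> r; rewrite /minor_row; case: ltnP => // br; apply: val_inj => /=.
by apply/eqP; rewrite eqn_leq br -ltnS ltn_ord.
Qed.

(** As [R] is upper triangular, columns 0, ..., b of [M *m R] combine only columns 0, ..., b of [M],
    so the submatrix is a product of square matrices. *)
Lemma minor_mulmx (a b : 'I_n) (M R : 'M[A]_n) :
  (forall i j : 'I_n, (j < i)%N -> R i j = 0) ->
  minor a b (M *m R) = minor a b M * minor b b R.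
Proof.
move=> hR; rewrite /minor -det_mulmx; congr (\det _); apply/matrixP => r c.
rewrite !mxE (bigID (fun k : 'I_n => (k < b.+1)%N)) /= [X in _ + X]big1.
  rewrite addr0 big_ord_narrow; apply: eq_bigr => k _.
  by rewrite !mxE minor_row_diag.
move=> k; rewrite -leqNgt => bk; rewrite hR ?mulr0 //=.
by apply: leq_trans bk.
Qed.

(** The selected submatrix is again lower triangular, with diagonal 1, ..., 1, [L a b]. This is how
    minors recover the entries of a unipotent factor. *)
Lemma minor_lower (a b : 'I_n) (L : 'M[A]_n) :
  (forall i j : 'I_n, (i < j)%N -> L i j = 0) -> (forall i, L i i = 1) ->
  minor a b L = L a b.
Proof.
move=> hL L1; rewrite /minor det_trig; last first.
  apply/is_trig_mxP => r c rc; rewrite mxE /minor_row.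
  by rewrite (leq_trans rc) -1?ltnS // hL.
rewrite big_ord_recr /= big1 ?mul1r => [|r _].
  by rewrite mxE /minor_row /= ltnn; congr (L _ _); apply: val_inj.
rewrite mxE /minor_row /= ltn_ord -(L1 (widen_ord (ltnW (ltn_ord b)) r)).
by congr (L _ _); apply: val_inj.
Qed.

End Minors.

Lemma minor_map (A B : comNzRingType) (f : {rmorphism A -> B}) n (a b : 'I_n)
    (M : 'M[A]_n) : minor a b (map_mx f M) = f (minor a b M).
Proof. by rewrite /minor -map_mxsub det_map_mx. Qed.

Section PermutedMinors.
Variables (K : fieldType) (n : nat).
Implicit Types (u : 'M[K]_n) (pi sigma : 'S_n).

Lemma mulmx_permutation u pi :
  u *m permutation_matrix K pi = \matrix_(i, j) u i (pi j).
Proof.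
apply/matrixP => i j; rewrite !mxE (bigD1 (pi j)) //= mxE eqxx mulr1.
by rewrite big1 ?addr0 // => k kj; rewrite mxE (negbTE kj) mulr0.
Qed.

Lemma row_perm_permutation u pi sigma :
  row_perm pi (u *m permutation_matrix K sigma) =
    \matrix_(i, j) u (pi i) (sigma j).
Proof. by rewrite mulmx_permutation; apply/matrixP => i j; rewrite !mxE. Qed.

(** A coarse numerical substitute for the Bruhat order: taken over all [b], these sums determine
    [pi], and they compare the cells that meet a common chart. *)
Definition partial_sum pi (b : 'I_n) : nat := \sum_(a < n | (a < b.+1)%N) pi a.

(* A nonzero term of the Leibniz expansion gives a permutation s of the first
   b + 1 indices with pi r <= sigma (s r) for all r. *)
Lemma minor_permuted_partial_sum u pi sigma (b : 'I_n) :
  upper_triangular u ->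
  minor b b (row_perm pi (u *m permutation_matrix K sigma)) != 0 ->
  (partial_sum pi b <= partial_sum sigma b)%N.
Proof.
move=> /upper_triangularP hu; rewrite row_perm_permutation => D0.
have /existsP[s /forallP hs] : [exists s : 'S_b.+1, forall r : 'I_b.+1,
    u (pi (widen_ord (ltn_ord b) r)) (sigma (widen_ord (ltn_ord b) (s r))) != 0].
  apply: contraNT D0; rewrite negb_exists => /forallP h; apply/eqP.
  rewrite /minor /determinant big1 // => s _.
  have := h s; rewrite negb_forall => /existsP[r]; rewrite negbK => /eqP ur.
  by rewrite (bigD1 r) //= !mxE minor_row_diag ur mul0r mulr0.
rewrite /partial_sum !big_ord_narrow [X in (_ <= X)%N](reindex_inj (@perm_inj _ s)).
apply: leq_sum => r _; rewrite leqNgt; apply/negP => lt.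
by have := hs r; rewrite hu ?eqxx.
Qed.

(** Only the identity term of the Leibniz expansion survives. The values [pi (s r)] and [pi r] have
    the same sum, so any other s has some r with [pi (s r)] smaller than [pi r], where [u] has a
    zero entry. *)
Lemma minor_conjugate_neq0 u pi (b : 'I_n) :
  upper_triangular u -> u \in unitmx ->
  minor b b (row_perm pi (u *m permutation_matrix K pi)) != 0.
Proof.
move=> hu; rewrite upper_triangular_unitmx // => /forallP u0.
have /upper_triangularP hu' := hu.
rewrite row_perm_permutation /minor /determinant (bigD1 1%g) //=.
rewrite [X in _ + X]big1 => [|s s1].
  rewrite addr0 odd_perm1 mul1r prodf_seq_neq0; apply/allP => r _ /=.
  by rewrite perm1 !mxE minor_row_diag u0.
suff /existsP[r lt] : [exists r : 'I_b.+1,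
    (pi (widen_ord (ltn_ord b) (s r)) < pi (widen_ord (ltn_ord b) r))%N].
  by rewrite (bigD1 r) //= !mxE minor_row_diag hu' // mul0r mulr0.
apply: contraNT s1; rewrite negb_exists => /forallP h; apply/eqP/permP => r.
pose f (r : 'I_b.+1) : nat := pi (widen_ord (ltn_ord b) r).
have le (i : 'I_b.+1) : true -> (f i <= f (s i) ?= iff (f i == f (s i)))%N.
  by move=> _; split=> //; rewrite leqNgt h.
have [_] := leqif_sum le.
rewrite [X in _ == X](_ : _ = \sum_i f i)%N; last first.
  by rewrite [RHS](reindex_inj (@perm_inj _ s)).
rewrite eqxx => /esym/forallP/(_ r)/eqP/esym/val_inj/perm_inj/(congr1 val)/= e.
by rewrite perm1; apply: val_inj.
Qed.

Lemma partial_sum_inj pi sigma :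
  (forall b, partial_sum pi b = partial_sum sigma b) -> pi = sigma.
Proof.
move=> h; apply/permP => b; apply: val_inj => /=.
elim/ltn_ind: {b}(b : nat) {-2}b (erefl (b : nat)) => m IH b bm.
have psE rho : partial_sum rho b = (rho b + \sum_(a < n | (a < b)%N) rho a)%N.
  rewrite /partial_sum (bigD1 b) //=; congr (_ + _)%N; apply: eq_bigl => a.
  by rewrite ltnS andbC ltn_neqAle.
have := h b; rewrite !psE.
rewrite (eq_bigr (fun a => (sigma a : nat))); first by move/addIn.
by move=> a ab; apply: (IH a) => //; rewrite -bm.
Qed.

End PermutedMinors.

(** * Column reduction and the Bruhat decomposition *)

Section ColumnEchelon.
Variables (K : fieldType) (n : nat).

(* Representatives of the cell of pi: the flags of B pi B are the u pi B with
   u of this form, which determines u. *)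
Definition cell_form (A : nzRingType) (pi : 'S_n) (u : 'M[A]_n) : Prop :=
  forall i j, u i j = 1 *+ (i == j) \/
    [/\ (i < j)%N & (filling pi j < filling pi i)%N].

(** [p c] is the pivot row of column [c]. Zeros are asked for below and to the right of a pivot
    only, since upper triangular column operations modify later columns by earlier ones. *)
Definition echelon (k : nat) (p : 'I_n -> 'I_n) (A : 'M[K]_n) : Prop :=
  forall c : 'I_n, (c < k)%N ->
    [/\ A (p c) c = 1, forall i : 'I_n, (p c < i)%N -> A i c = 0 &
        forall c' : 'I_n, (c < c')%N -> A (p c) c' = 0].

Lemma echelon_step (k : 'I_n) p (A : 'M[K]_n) :
  A \in unitmx -> echelon k p A ->
  exists p' b, [/\ b \in unitmx, upper_triangular b & echelon k.+1 p' (A *m b)].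
Proof.
move=> uA hA.
have [i0 Ai0] : exists i, A i k != 0.
  apply: contrapT => /forallNP h; move: uA; rewrite unitmxE unitfE.
  rewrite (expand_det_col _ k) big1 ?eqxx // => i _.
  by move/negP: (h i); rewrite negbK => /eqP ->; rewrite mul0r.
(* The pivot is the lowest nonzero entry of column [k]. *)
have [i Aik imax] := @arg_maxnP _ i0 (fun i => A i k != 0) (fun i => i) Ai0.
(* [b] is the identity plus the row [y] placed in row [k]. It scales column [k] and clears the pivot
   row to the right; the [- 1] makes up for the diagonal entry of the identity. *)
pose y (l : 'I_n) := if l == k then (A i k)^-1 - 1 else
  if (k < l)%N then - A i l / A i k else 0.
pose b : 'M[K]_n := \matrix_(r, c) ((r == c)%:R + (r == k)%:R * y c).
have bu : upper_triangular b.
  apply/upper_triangularP => r c cr; rewrite !mxE -val_eqE gtn_eqF //= add0r.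
  have [rk|] := eqVneq r k; last by rewrite mul0r.
  by rewrite /y -rk -val_eqE ltn_eqF //= ltnNge (ltnW cr) mulr0.
have AbE r c : (A *m b) r c = A r c + A r k * y c.
  rewrite mxE (eq_bigr (fun l => A r l * (l == c)%:R + A r l * (l == k)%:R * y c)).
    rewrite big_split /= -mulr_suml; congr (_ + _ * _).
      rewrite (bigD1 c) //= eqxx mulr1 big1 ?addr0 // => l lc.
      by rewrite (negbTE lc) mulr0.
    rewrite (bigD1 k) //= eqxx mulr1 big1 ?addr0 // => l lc.
    by rewrite (negbTE lc) mulr0.
  by move=> l _; rewrite mxE mulrDr mulrA.
exists (fun c => if c == k then i else p c), b; split=> //.
  rewrite upper_triangular_unitmx //; apply/forallP => l; rewrite !mxE eqxx /y.
  have [_|_] := eqVneq l k; last by rewrite mul0r addr0 oner_eq0.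
  by rewrite mul1r addrC subrK invr_eq0.
move=> c; rewrite ltnS leq_eqVlt => /orP[/eqP/val_inj ->|ck].
  rewrite eqxx; split=> [|r ir|c' kc']; rewrite AbE /y ?eqxx.
  - by rewrite mulrBr mulr1 divff // addrC subrK.
  - suff -> : A r k = 0 by rewrite mul0r addr0.
    by apply/eqP; apply: contraTT ir => /imax; rewrite -leqNgt.
  - by rewrite -val_eqE gtn_eqF // kc' mulrC divfK // subrr.
have [A1 Al Ar] := hA c ck; rewrite -val_eqE ltn_eqF //.
have yc : y c = 0 by rewrite /y -val_eqE ltn_eqF // ltnNge (ltnW ck).
split=> [|r pr|c' cc']; rewrite AbE ?yc ?mulr0 ?addr0 //; first exact: Al.
by rewrite !Ar // mul0r addr0.
Qed.

(** The pivots of a completely reduced matrix lie in distinct rows and thus define a permutation.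
    The matrix [u] is the reduced matrix with its columns reordered so that the pivot of row j
    stands in column j. *)
Lemma echelon_form (g : 'M[K]_n) : g \in unitmx ->
  exists pi u b, [/\ cell_form pi u, b \in unitmx, upper_triangular b &
    g *m b = u *m permutation_matrix K pi].
Proof.
move=> ug.
have [p [b [ub hb hp]]] : exists p b, [/\ b \in unitmx, upper_triangular b &
    echelon n p (g *m b)].
  suff h k : (k <= n)%N -> exists p b, [/\ b \in unitmx, upper_triangular b &
    echelon k p (g *m b)] by exact: h.
  elim: k => [_|k IHk kn].
    by exists id, 1%:M; split=> //; [exact: unitmx1|exact: upper_triangular1].
  have [p [b [ub hb hp]]] := IHk (ltnW kn).
  have [||p' [b' [ub' hb' hp']]] := @echelon_step (Ordinal kn) p (g *m b).
  - by rewrite unitmx_mul ug.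
  - exact: hp.
  exists p', (b *m b'); split; rewrite ?unitmx_mul ?ub ?mulmxA //.
  exact: upper_triangularM.
have pinj : injective p.
  move=> c c' pc; apply: val_inj => /=; apply/eqP; rewrite eqn_leq; apply/andP.
  (* If two columns had the same pivot row, the pivot of the later one would have been cleared by
     the earlier one. *)
  have key (d d' : 'I_n) : p d = p d' -> (d' <= d)%N.
    move=> pd; rewrite leqNgt; apply/negP => dd'.
    have [_ _ /(_ d' dd')] := hp d (ltn_ord d).
    have [] := hp d' (ltn_ord d'); rewrite -pd => -> _ _ /eqP.
    by rewrite oner_eq0.
  by split; apply: key.
pose u := \matrix_(i, j) (g *m b) i ((perm pinj)^-1 j)%g.
exists (perm pinj), u, b; split=> //; last first.
  by rewrite mulmx_permutation; apply/matrixP => i j; rewrite [RHS]mxE /u [RHS]mxE permK.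
move=> i j; rewrite mxE; set c := ((perm pinj)^-1)%g j.
have pc : p c = j by rewrite -(permE pinj) permKV.
have [A1 Al Ar] := hp c (ltn_ord c); rewrite pc in A1 Al Ar.
have [->|ij] := eqVneq i j; first by left.
have [ji|ij'] := ltnP j i; first by left; rewrite Al.
have lij : (i < j)%N by rewrite ltn_neqAle ij.
rewrite /filling -/c; set d := ((perm pinj)^-1)%g i.
have pd : p d = i by rewrite -(permE pinj) permKV.
have [dc|cd] := ltnP c d; first by right.
left; have [_ _] := hp d (ltn_ord d); rewrite pd; apply.
rewrite ltn_neqAle cd andbT; apply: contraNN ij => /eqP/val_inj dc.
by rewrite -pc -pd dc.
Qed.

End ColumnEchelon.

Lemma cell_form_diag (A : nzRingType) n (pi : 'S_n) (u : 'M[A]_n) i :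
  cell_form pi u -> u i i = 1.
Proof. by move=> hu; case: (hu i i) => [->|[]]; rewrite ?eqxx ?ltnn. Qed.

Lemma cell_form_lower (A : nzRingType) n (pi : 'S_n) (u : 'M[A]_n) (i j : 'I_n) :
  cell_form pi u -> (j < i)%N -> u i j = 0.
Proof.
move=> hu ji; case: (hu i j) => [->|[]]; first by rewrite -val_eqE gtn_eqF.
by rewrite ltnNge (ltnW ji).
Qed.

Lemma cell_form_upper (K : fieldType) n (pi : 'S_n) (u : 'M[K]_n) :
  cell_form pi u -> upper_triangular u.
Proof. by move=> hu; apply/upper_triangularP => i j; apply: cell_form_lower hu. Qed.

Lemma cell_form_unitmx (K : fieldType) n (pi : 'S_n) (u : 'M[K]_n) :
  cell_form pi u -> u \in unitmx.
Proof.
move=> hu; rewrite upper_triangular_unitmx ?(cell_form_upper hu) //.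
by apply/forallP => i; rewrite (cell_form_diag _ hu) oner_eq0.
Qed.

Lemma permutation_matrix_unitmx (K : fieldType) n (pi : 'S_n) :
  permutation_matrix K pi \in unitmx.
Proof.
have -> : permutation_matrix K pi = (perm_mx pi)^T.
  by apply/matrixP => i j; rewrite !mxE eq_sym.
by rewrite unitmx_tr unitmx_perm.
Qed.

(** * Hessenberg spaces as zero patterns *)

Section HessenbergSpaces.
Variables (K : fieldType) (n : nat) (H : {vspace 'M[K]_n}) (h : 'I_n -> 'I_n).
Hypotheses (H_hess : hessenberg_space H) (Hh : corresponding_function H h).

Lemma hessenberg_function_mono (i j : 'I_n) : (i <= j)%N -> (h i <= h j)%N.
Proof.
have [[_ hS] _] := Hh.
elim/ltn_ind: {j}(j : nat) {-2}j (erefl (j : nat)) => m IH j jm ij.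
have [/val_inj -> //|ne] := eqVneq (i : nat) j.
have lij : (i < j)%N by rewrite ltn_neqAle ne.
have j'n : (j.-1 < n)%N by apply: leq_ltn_trans (leq_pred _) (ltn_ord j).
apply: (@leq_trans (h (Ordinal j'n))); first by apply: (IH j.-1) => //=; lia.
by apply: hS => /=; lia.
Qed.

(** For j < i, bracketing A with [delta_mx i i] and then with [delta_mx j j] leaves, up to sign, the
    sum of the parts of A at (i, j) and (j, i). The latter is upper triangular, so a nonzero [A i j]
    puts [delta_mx i j] into [H]. *)
Lemma mem_hessenberg_space (A : 'M[K]_n) :
  A \in H <-> forall i j : 'I_n, (h j < i)%N -> A i j = 0.
Proof.
have [Hb Hbr] := H_hess; have [[h_ge _] hE] := Hh; split=> [AH i j hji|hA].
  have ji : (j < i)%N by apply: leq_ltn_trans (h_ge j) hji.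
  apply: contraTeq hji => Aij; rewrite -leqNgt -hE.
  have diag k : upper_triangular (delta_mx k k : 'M[K]_n).
    apply/upper_triangularP => r c cr; rewrite mxE.
    by case: eqP => //= rk; case: eqP => //= ck; move: cr; rewrite rk ck ltnn.
  have dm k l r s : (delta_mx k l *m A *m delta_mx r s) = A l r *: delta_mx k s.
    apply/matrixP => x y; rewrite !mxE (bigD1 r) //= big1 ?addr0 => [|z zr].
      rewrite !mxE eqxx (bigD1 l) //= big1 ?addr0 => [|z zl].
        by rewrite !mxE eqxx andbT mulrAC mulrC -natrM mulnb.
      by rewrite mxE (negbTE zl) andbF mul0r.
    by rewrite [X in _ * X]mxE (negbTE zr) mulr0.
  have := Hbr _ _ (diag j) (Hbr _ _ (diag i) AH).
  rewrite mulmxBr mulmxBl !mulmxA.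
  rewrite [delta_mx j j *m delta_mx i i](_ : _ = 0); last first.
    by rewrite mul_delta_mx_cond -val_eqE ltn_eqF.
  rewrite -[A *m delta_mx i i *m delta_mx j j]mulmxA.
  rewrite mul_delta_mx_cond -val_eqE gtn_eqF // mulr0n mulmx0 mul0mx sub0r subr0.
  rewrite !dm -opprD rpredN addrC rpredDr => [|].
    by rewrite rpredZeq (negbTE Aij).
  apply/memvZ/Hb/upper_triangularP => r c cr; rewrite mxE.
  by case: eqP => //= e1; case: eqP => //= e2; move: cr ji; rewrite e1 e2; lia.
rewrite [A]matrix_sum_delta; apply: memv_suml => i _; apply: memv_suml => j _.
have [ij|ji] := leqP i (h j); first by apply: memvZ; rewrite hE.
by rewrite hA // scale0r mem0v.
Qed.

(** The bracket condition is infinitesimal; stability under the group is read off the zero pattern,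
    which is a staircase because [h] is nondecreasing. *)
Lemma hessenberg_space_conj (A b b' : 'M[K]_n) :
  upper_triangular b -> upper_triangular b' -> A \in H -> b *m A *m b' \in H.
Proof.
move=> /upper_triangularP hb /upper_triangularP hb' /mem_hessenberg_space hA.
apply/mem_hessenberg_space => i j hji; rewrite mxE big1 // => l _; rewrite mxE.
have [jl|lj] := ltnP j l; first by rewrite hb' ?mulr0.
rewrite big1 ?mul0r // => k _.
have [ki|ik] := ltnP k i; first by rewrite hb ?mul0r.
rewrite hA ?mulr0 //; apply: leq_trans ik; apply: leq_ltn_trans hji.
exact: hessenberg_function_mono.
Qed.

End HessenbergSpaces.

(** * The equation of a cell *)

Section Parametrization.
Variables (n : nat) (D : rel 'I_n) (h : 'I_n -> 'I_n) (pi : 'S_n).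
Local Notation tau := (filling pi).

(* [D j k] stands for: box k lies directly above box j. *)
Record stacking : Prop := Stacking {
  stacking_lt : forall j k : 'I_n, D j k -> (j < k)%N;
  stacking_mono : forall j k j' k' : 'I_n, D j k -> D j' k' -> (k' < k)%N -> (j' < j)%N;
  stacking_fun : forall j j' k, D j k -> D j' k -> j = j';
  stacking_inj : forall j k k', D j k -> D j k' -> k = k';
  stacking_down : forall j' k' k : 'I_n, D j' k' -> (k' <= k)%N -> exists j, D j k
}.
Hypothesis HD : stacking.

(** The entries of a cell form on which no equation is imposed. The last clause is vacuous when no
    box lies above j, which separates the two quantities of the dimension formula. *)
Definition free_pair (i j : 'I_n) : bool :=
  [&& (i < j)%N, (tau j < tau i)%N & [forall k, D j k ==> (tau i <= h (tau k))%N]].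

Definition free_pairs : {set 'I_n * 'I_n} := [set p | free_pair p.1 p.2]%SET.

Section Ring.
Variable A : comNzRingType.
Implicit Types (t u c : 'M[A]_n).

Definition stacking_mx : 'M[A]_n := \matrix_(i, j) (D i j)%:R.
Local Notation N := stacking_mx.

(* For u in cell form and N u = u c, the entry (i, k) of this equation with
   k above j reads
     u_ij + c_ik = (N u)_ik - sum_(i < m < j) u_im c_mk.
   Requiring c_ik = 0 determines u_ij; the right-hand side only involves lower
   rows and entries of row i further to the left, so iterating [step] from any
   matrices yields the solution with free entries t. *)
Definition step t (x : 'M[A]_n * 'M[A]_n) : 'M[A]_n * 'M[A]_n :=
  let: (u, c) := x in
  (\matrix_(i, j)
     if i == j then 1 else
     if ~~ ((i < j)%N && (tau j < tau i)%N) then 0 else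
     if free_pair i j then t i j else
     \sum_k (D j k)%:R *
       ((N *m u) i k - \sum_(m < n | (i < m < j)%N) u i m * c m k),
   \matrix_(i, k) ((N *m u) i k - \sum_(m < n | (i < m)%N) u i m * c m k)).

(** Entries are ranked in the order in which [step] determines them: rows by decreasing index,
    [n.+1] ranks per row, rank j within the row for [u i j] and the final rank n for all [c i k].
    Each entry of [step t x] depends only on entries of [x] of smaller rank. *)
Definition agree (m : nat) (x y : 'M[A]_n * 'M[A]_n) : Prop :=
  (forall i j : 'I_n, ((n - i.+1) * n.+1 + j < m)%N -> x.1 i j = y.1 i j) /\
  (forall i k : 'I_n, ((n - i.+1) * n.+1 + n < m)%N -> x.2 i k = y.2 i k).

Lemma sum_above (j k : 'I_n) (F : 'I_n -> A) :
  D j k -> \sum_l (D j l)%:R * F l = F k.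
Proof.
move=> jk; rewrite (bigD1 k) //= jk mul1r big1 ?addr0 // => l lk.
have [jl|] := boolP (D j l); last by rewrite mul0r.
by case/eqP: lk; apply: (stacking_inj HD jl jk).
Qed.

Lemma lower_row_rank (i i' : 'I_n) (a b m : nat) :
  (i < i')%N -> (a <= n)%N -> ((n - i.+1) * n.+1 + b < m.+1)%N ->
  ((n - i'.+1) * n.+1 + a < m)%N.
Proof.
move=> ii' an hm; have i'n := ltn_ord i'.
have : ((n - i'.+1).+1 * n.+1 <= (n - i.+1) * n.+1)%N by apply: leq_mul => //; lia.
rewrite mulSn; lia.
Qed.

Lemma stacking_mulmx_eq (i k : 'I_n) u u' :
  (forall l : 'I_n, (i < l)%N -> u l k = u' l k) -> (N *m u) i k = (N *m u') i k.
Proof.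
move=> huu'; rewrite !mxE; apply: eq_bigr => l _; rewrite !mxE.
have [/(stacking_lt HD) il|] := boolP (D i l); last by rewrite !mul0r.
by rewrite huu'.
Qed.

Lemma step_agree t m x y : agree m x y -> agree m.+1 (step t x) (step t y).
Proof.
case: x y => [u c] [u' c'] [hu hc]; split=> /= i j hm; rewrite [LHS]mxE [RHS]mxE.
  case: ifP => // _; case: ifP => // _; case: ifP => // _.
  apply: eq_bigr => k _; congr (_ * (_ - _)).
    apply: stacking_mulmx_eq => l il; apply: hu.
    exact: lower_row_rank il (ltnW (ltn_ord k)) hm.
  apply: eq_bigr => l /andP[il lj]; congr (_ * _).
    by apply: hu => /=; lia.
  by apply: hc; apply: lower_row_rank il _ hm.
congr (_ - _).
  apply: stacking_mulmx_eq => l il; apply: hu.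
  exact: lower_row_rank il (ltnW (ltn_ord j)) hm.
apply: eq_bigr => l il; congr (_ * _).
  by apply: hu => /=; have := ltn_ord l; lia.
by apply: hc; apply: lower_row_rank il _ hm.
Qed.

Lemma iter_step_agree t m x y : agree m (iter m (step t) x) (iter m (step t) y).
Proof. by elim: m => [|m IHm]; [split | apply: step_agree]. Qed.

Lemma agree_all x y : agree (n * n.+1) x y -> x = y.
Proof.
case: x y => [u c] [u' c'] [/= hu hc].
have rk (i : 'I_n) (a : nat) : (a <= n)%N -> ((n - i.+1) * n.+1 + a < n * n.+1)%N.
  move=> an; have i_n := ltn_ord i.
  have : ((n - i.+1).+1 * n.+1 <= n * n.+1)%N.
    by apply: leq_mul => //; lia.
  by rewrite mulSn; lia.
by congr (_, _); apply/matrixP => i j; [apply: hu | apply: hc];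
  apply: rk => //; apply: ltnW.
Qed.

(** All ranks are below [n * n.+1], so this many rounds determine every entry from any starting pair
    and produce the unique fixed point of [step t]. *)
Definition solution t := iter (n * n.+1) (step t) (0, 0).

Lemma solution_fixpoint t : step t (solution t) = solution t.
Proof. by rewrite /solution -iterS iterSr; apply/agree_all/iter_step_agree. Qed.

Lemma solution_unique t x : step t x = x -> x = solution t.
Proof.
move=> fx; have -> : x = iter (n * n.+1) (step t) x.
  by elim: (n * n.+1)%N => //= m <-.
exact/agree_all/iter_step_agree.
Qed.

Definition param t := (solution t).1.

Lemma param_free t i j : free_pair i j -> param t i j = t i j.
Proof.
move=> fij; rewrite /param -solution_fixpoint; case: solution => u c /=.
have /and3P[ij ji _] := fij.
by rewrite mxE fij ij ji /= -val_eqE ltn_eqF.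
Qed.

Lemma eq_param t t' :
  (forall i j, free_pair i j -> t i j = t' i j) -> param t = param t'.
Proof.
move=> htt'; rewrite /param; congr (_.1); apply: solution_unique.
rewrite -[RHS]solution_fixpoint; case: solution => u c; congr (_, _).
by apply/matrixP => i j; rewrite !mxE; case: ifP => // _; case: ifP => // _;
  case: ifP => // fij; rewrite htt'.
Qed.

Lemma param_cell_form t : cell_form pi (param t).
Proof.
move=> i j; rewrite /param -solution_fixpoint; case: solution => u c /=.
rewrite mxE; case: eqP => [_|_]; first by left.
case: ifP => [_|]; first by left.
by move=> /negbFE/andP[ij ji]; right.
Qed.

Section Equation.
Variables (u c : 'M[A]_n).
Hypotheses (u_cell : cell_form pi u) (uc : N *m u = u *m c).

Lemma equation_entry (i k : 'I_n) :
  (N *m u) i k = c i k + \sum_(m < n | (i < m)%N) u i m * c m k.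
Proof.
rewrite uc mxE (bigD1 i) //= (cell_form_diag _ u_cell) mul1r; congr (_ + _).
rewrite (bigID (fun m : 'I_n => (i < m)%N)) /= [X in _ + X]big1 ?addr0.
  by apply: eq_bigl => m; rewrite -val_eqE; case: ltngtP; rewrite ?andbF.
move=> m /andP[mi]; rewrite -leqNgt => mi'.
by rewrite (cell_form_lower u_cell) ?mul0r // ltn_neqAle mi' andbT.
Qed.

(** Back substitution from the last row upwards, [u] being unitriangular. *)
Lemma equation_vanish (b : nat) (k : 'I_n) :
  (forall i : 'I_n, (b <= i)%N -> (N *m u) i k = 0) ->
  forall i : 'I_n, (b <= i)%N -> c i k = 0.
Proof.
move=> hb i; have [m] := ubnP (n - i); elim: m i => // m IHm i im bi.
have := hb i bi; rewrite equation_entry big1 ?addr0 // => l il.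
rewrite IHm ?mulr0 //; first by have := ltn_ord l; lia.
exact: leq_trans bi (ltnW il).
Qed.

Lemma stacking_mulmx_neq0 (i k : 'I_n) :
  (N *m u) i k != 0 -> exists2 l : 'I_n, D i l & (l <= k)%N.
Proof.
move=> Nu; apply: contrapT => hl; case/eqP: Nu; rewrite mxE big1 // => l _.
rewrite mxE; have [il|] := boolP (D i l); last by rewrite mul0r.
have [lk|kl] := leqP l k; first by case: hl; exists l.
by rewrite (cell_form_lower u_cell) // mulr0.
Qed.

(** A nonzero (N u)_ik requires a box l <= k above i. Stacking preserves the order of boxes, so i <=
    j: column k of N u, and hence of [c], vanishes below row j, and in row j it is [u k k]. *)
Lemma equation_above (j k : 'I_n) : D j k ->
  c j k = 1 /\ forall i : 'I_n, (j < i)%N -> c i k = 0.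
Proof.
move=> jk.
have c0 (i : 'I_n) : (j.+1 <= i)%N -> c i k = 0.
  apply: equation_vanish => {}i ji; apply/eqP; apply: contraTT ji.
  move=> /stacking_mulmx_neq0[l il]; rewrite -leqNgt leq_eqVlt => /orP[/eqP/val_inj lk|lk].
    by rewrite (stacking_fun HD il (_ : D j l)) ?lk.
  exact: ltnW (stacking_mono HD jk il lk).
split=> //; have := equation_entry j k.
rewrite [X in _ = _ + X]big1 ?addr0 => [<-|m jm]; last by rewrite c0 ?mulr0.
rewrite mxE -[RHS](cell_form_diag k u_cell) -(sum_above (fun l => u l k) jk).
by apply: eq_bigr => l _; rewrite mxE.
Qed.

Lemma equation_no_below (k : 'I_n) : (forall j, ~~ D j k) -> forall i, c i k = 0.
Proof.
move=> hk i; apply: (@equation_vanish 0) => // {}i _; apply/eqP.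
apply: contrapT => /negP/stacking_mulmx_neq0[l il lk].
have [j jk] := stacking_down HD il lk.
by have := hk j; rewrite jk.
Qed.

(** In row i of the equation the term m = j is [u i j], because [c j k] is 1, and the terms with m >
    j vanish. This justifies the recursion in [step]. *)
Lemma equation_above_entry (i j k : 'I_n) : D j k -> (i < j)%N ->
  u i j + c i k = (N *m u) i k - \sum_(m < n | (i < m < j)%N) u i m * c m k.
Proof.
move=> jk ij; have [cjk c0] := equation_above jk.
rewrite equation_entry (bigID (fun m : 'I_n => (m < j)%N)) /=.
rewrite [X in _ = _ + (_ + X) - _](bigD1 j) /=; last by rewrite ij ltnn.
rewrite cjk mulr1 [X in _ = _ + (_ + (_ + X)) - _]big1.
  by ring.
move=> m /andP[/andP[_ mj] mj']; rewrite c0 ?mulr0 //.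
by rewrite ltn_neqAle eq_sym mj' leqNgt mj.
Qed.

End Equation.

(** The second component of the fixed point encodes N u = u c. If k lies above j, then [c i k]
    vanishes for i < j by the choice of the non-free [u i j] and for i > j by [equation_above],
    while i = j contradicts admissibility. If nothing lies below k, all of column k of [c]
    vanishes. *)
Lemma param_equation t :
  (forall j k : 'I_n, D j k -> (tau j <= h (tau k))%N) ->
  exists2 c, N *m param t = param t *m c &
    forall i k : 'I_n, (h (tau k) < tau i)%N -> c i k = 0.
Proof.
move=> hadm; have := param_cell_form t; rewrite /param => hu.
set c := (solution t).2; set u := (solution t).1.
have [uE cE] : (forall i j, u i j = (step t (u, c)).1 i j) /\
   (forall i j, c i j = (step t (u, c)).2 i j).
  by rewrite -surjective_pairing solution_fixpoint.
have uc : N *m u = u *m c.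
  apply/matrixP => i k; rewrite [RHS]mxE (bigD1 i) //= (cell_form_diag _ hu) mul1r.
  rewrite (_ : c i k = (N *m u) i k - \sum_(m < n | (i < m)%N) u i m * c m k).
    rewrite -addrA -[LHS]addr0; congr (_ + _); apply/esym/eqP.
    rewrite addrC subr_eq0; apply/eqP.
    rewrite (bigID (fun m : 'I_n => (i < m)%N)) /= [X in _ + X]big1 ?addr0.
      by apply: eq_bigl => m; rewrite -val_eqE; case: ltngtP; rewrite ?andbF.
    move=> m /andP[mi]; rewrite -leqNgt => mi'.
    by rewrite (cell_form_lower hu) ?mul0r // ltn_neqAle mi' andbT.
  by rewrite cE mxE.
exists c => // i k hik.
have [/existsP[j jk]|] := boolP [exists j, D j k]; last first.
  by rewrite negb_exists => /forallP hk; apply: (equation_no_below hu uc).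
have [ij|ji|/val_inj ij] := ltngtP i j.
- have := equation_above_entry hu uc jk ij.
  suff -> : u i j = (N *m u) i k - \sum_(m < n | (i < m < j)%N) u i m * c m k.
    by move/eqP; rewrite addrC -subr_eq0 addrK => /eqP.
  have ji : (tau j < tau i)%N by apply: leq_ltn_trans hik; apply: hadm.
  have nf : free_pair i j = false.
    apply: contraTF hik => /and3P[_ _ /forallP/(_ k)]; rewrite jk /=.
    by rewrite -leqNgt.
  rewrite {1}uE mxE -val_eqE ltn_eqF // ij ji nf /=.
  exact: sum_above jk.
- by have [_] := equation_above hu uc jk; apply.
- by have := hadm _ _ jk; rewrite -ij leqNgt hik.
Qed.

(** The pair [(u, c)] is a fixed point of [step u], and fixed points are unique. *)
Lemma equation_param u c :
  cell_form pi u -> N *m u = u *m c ->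
  (forall i k : 'I_n, (h (tau k) < tau i)%N -> c i k = 0) -> u = param u.
Proof.
move=> hu uc hc; rewrite /param -(_ : (u, c) = solution u) //.
apply: solution_unique; congr (_, _); apply/matrixP => i j; rewrite mxE.
  have [<-|ij] := eqVneq i j; first by rewrite (cell_form_diag _ hu).
  case: ifPn => [nij|/negbNE/andP[lij ltij]].
    by case: (hu i j) => [->|[h1 h2]]; [rewrite (negbTE ij) | rewrite h1 h2 in nij].
  case: ifPn => // nf.
  have /existsP[k /andP[jk hk]] : [exists k, D j k && (h (tau k) < tau i)%N].
    move: nf; rewrite /free_pair lij ltij /= negb_forall => /existsP[k].
    by rewrite negb_imply -ltnNge => hk; apply/existsP; exists k.
  by rewrite (sum_above _ jk) -(equation_above_entry hu uc jk lij) hc ?addr0.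
by rewrite (equation_entry hu uc) addrK.
Qed.

Lemma equation_admissible u c :
  cell_form pi u -> N *m u = u *m c ->
  (forall i k : 'I_n, (h (tau k) < tau i)%N -> c i k = 0) ->
  forall j k : 'I_n, D j k -> (tau j <= h (tau k))%N.
Proof.
move=> hu uc hc j k jk; rewrite leqNgt; apply/negP => /hc.
by have [-> _] := equation_above hu uc jk; move/eqP; rewrite oner_eq0.
Qed.

End Ring.

Lemma map_stacking_mx (A B : comNzRingType) (f : {rmorphism A -> B}) :
  map_mx f (stacking_mx A) = stacking_mx B.
Proof. by apply/matrixP => i j; rewrite !mxE rmorph_nat. Qed.

(** [step] uses only ring operations. Applied to evaluation morphisms, this shows that the entries
    of [param] are polynomials in [t]. *)
Lemma map_param (A B : comNzRingType) (f : {rmorphism A -> B}) (t : 'M[A]_n) :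
  map_mx f (param t) = param (map_mx f t).
Proof.
pose F (x : 'M[A]_n * 'M[A]_n) := (map_mx f x.1, map_mx f x.2).
have Fstep x : F (step t x) = step (map_mx f t) (F x).
  case: x => u c; congr (_, _); apply/matrixP => i j.
    rewrite !mxE; case: ifP => _; first by rewrite rmorph1.
    case: ifP => _; first by rewrite rmorph0.
    case: ifP => _ //; rewrite rmorph_sum; apply: eq_bigr => k _.
    rewrite rmorphM rmorph_nat rmorphB rmorph_sum; congr (_ * (_ - _)).
      by rewrite -(map_stacking_mx f) -map_mxM [RHS]mxE.
    by apply: eq_bigr => m _; rewrite rmorphM !mxE.
  rewrite mxE [in LHS]mxE [RHS]mxE rmorphB rmorph_sum; congr (_ - _).
    by rewrite -(map_stacking_mx f) -map_mxM [RHS]mxE.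
  by apply: eq_bigr => m _; rewrite rmorphM !mxE.
suff: F (solution t) = solution (map_mx f t) by move/(congr1 fst).
rewrite /solution; elim: (n * n.+1)%N => [|m IHm].
  by rewrite /F /= map_mx0.
by rewrite !iterS Fstep IHm.
Qed.

End Parametrization.

(** * Young diagrams *)

Section YoungDiagrams.
Variable mu : seq nat.
Hypothesis mu_part : is_partition mu.

Lemma row_length_antitone r r' :
  (r <= r')%N -> (row_length mu r' <= row_length mu r)%N.
Proof. by move=> rr'; apply: sub_count => m; apply: leq_ltn_trans. Qed.

Lemma mem_boxes r c :
  ((r, c) \in boxes mu) = (r < head 0%N mu)%N && (c < row_length mu r)%N.
Proof.
apply/allpairsPdep/andP => [[r' [c' []]]|[hr hc]].
  by rewrite mem_rev !mem_iota !add0n /= => hr hc [-> ->].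
by exists r, c; rewrite mem_rev !mem_iota !add0n.
Qed.

Lemma partition_le_head m : m \in mu -> (m <= head 0%N mu)%N.
Proof.
case/andP: mu_part => smu _; case: (mu) smu => //= x s xs.
rewrite inE => /predU1P[-> //|ms].
by have /allP/(_ m ms) := order_path_min (rev_trans leq_trans) xs.
Qed.

(** Exchanging the sums counts the boxes by columns instead of rows. *)
Lemma size_boxes : size (boxes mu) = \sum_(m <- mu) m.
Proof.
rewrite size_allpairs_dep sumnE big_map -[X in iota 0 X]subn0 -/(index_iota _ _) big_mkord.
under eq_bigr => r _ do rewrite size_rev size_iota /row_length -sum1_count big_mkcond.
rewrite exchange_big big_seq [RHS]big_seq; apply: eq_bigr => m /partition_le_head mh.
by rewrite -big_mkcond (big_ord_narrow mh) sum1_card card_ord.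
Qed.

Definition right_or_below_box (p q : nat * nat) : bool :=
  (p.1 < q.1)%N || ((p.1 == q.1) && (q.2 < p.2)%N).

Lemma boxes_pairwise : pairwise right_or_below_box (boxes mu).
Proof.
rewrite /boxes; elim: (head 0%N mu) => [|r IHr] //.
rewrite -addn1 iotaD map_cat flatten_cat pairwise_cat IHr /= cats0 add0n.
apply/andP; split.
  apply/allrelP => p q /allpairsPdep[r' [c [+ _ ->]]] /mapP[c' _ ->].
  by rewrite mem_iota /right_or_below_box /= => ->.
rewrite pairwise_map; apply: (@sub_pairwise _ (fun c c' => c' < c)%N).
  by move=> c c' cc'; rewrite /right_or_below_box /= eqxx cc' orbT.
rewrite -sorted_pairwise; last by move=> x y z; apply: rev_trans ltn_trans _ _ _.
by rewrite rev_sorted iota_ltn_sorted.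
Qed.

Lemma right_or_belowE i j : (i < size (boxes mu))%N -> (j < size (boxes mu))%N ->
  right_or_below mu i j = (i < j)%N.
Proof.
have key k l : (k < l)%N -> (l < size (boxes mu))%N -> right_or_below mu k l.
  move=> kl ls; apply: (pairwiseP (0%N, 0%N) boxes_pairwise) => //.
  exact: ltn_trans ls.
move=> hi hj; case: ltngtP => [ij|ji|->]; first exact: key.
  by have := key _ _ ji hi; rewrite /right_or_below; case: ltngtP; case: ltngtP.
by rewrite /right_or_below ltnn eqxx ltnn.
Qed.

Variable n : nat.
Hypothesis size_mu : size (boxes mu) = n.

Lemma box_inj (i j : 'I_n) : box mu i = box mu j -> i = j.
Proof.
move=> e; apply: val_inj; apply/eqP; rewrite eqn_leq.
have h (k l : 'I_n) : box mu k = box mu l -> (k <= l)%N.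
  move=> kl; rewrite leqNgt -right_or_belowE ?size_mu //.
  by rewrite /right_or_below kl ltnn eqxx ltnn.
by rewrite !h.
Qed.

Definition above (j k : 'I_n) : bool := directly_above mu k j.

Lemma stacking_above : stacking above.
Proof.
have rbE (i j : 'I_n) : right_or_below mu i j = (i < j)%N.
  by apply: right_or_belowE; rewrite size_mu.
split.
- move=> j k /andP[/eqP r _]; rewrite -rbE /right_or_below r ltnSn //.
- move=> j k j' k' /andP[/eqP r /eqP c] /andP[/eqP r' /eqP c'].
  by rewrite -!rbE /right_or_below r r' c c' ltnS eqSS.
- move=> j j' k /andP[/eqP r /eqP c] /andP[/eqP r' /eqP c']; apply: box_inj.
  apply/eqP; rewrite [box mu j]surjective_pairing [box mu j']surjective_pairing.
  by rewrite xpair_eqE -c -c' eqxx andbT -eqSS -r -r'.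
- move=> j k k' /andP[/eqP r /eqP c] /andP[/eqP r' /eqP c']; apply: box_inj.
  apply/eqP; rewrite [box mu k]surjective_pairing [box mu k']surjective_pairing.
  by rewrite xpair_eqE c c' r r' !eqxx.
- move=> j' k' k /andP[/eqP r _] k'k.
  (* Row numbers weakly increase with the index, so [k] is no lower than [k'], which is above the
     bottom row. *)
  have rk : (0 < (box mu k).1)%N.
    apply: (@leq_trans (box mu k').1); first by rewrite r.
    move: k'k; rewrite leq_eqVlt => /orP[/eqP -> //|].
    by rewrite -rbE => /orP[/ltnW //|/andP[/eqP ->]].
  have : box mu k \in boxes mu by rewrite mem_nth // size_mu.
  case E: (box mu k) rk => [[//|r0] c0] _; rewrite mem_boxes => /andP[hr hc].
  have bk : (r0, c0) \in boxes mu.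
    rewrite mem_boxes (ltn_trans _ hr) //=; apply: leq_trans hc _.
    exact: row_length_antitone.
  have hi : (index (r0, c0) (boxes mu) < n)%N by rewrite -size_mu index_mem.
  exists (Ordinal hi); rewrite /above /directly_above E /box nth_index //=.
  by rewrite !eqxx.
Qed.

End YoungDiagrams.

Lemma jordan_type_size (K : fieldType) n (N : 'M[K]_n) mu :
  jordan_type N mu -> \sum_(m <- mu) m = n.
Proof.
move=> [P [Q [PQ QP _]]]; rewrite (big_nth 0%N) big_mkord.
by apply/eqP; rewrite eqn_leq (mulmx1_min PQ) (mulmx1_min QP).
Qed.

Lemma matrix_in_young_basis (K : fieldType) n (N e : 'M[K]_n) mu :
  is_partition mu -> jordan_type N mu -> young_basis N mu e ->
  matrix_in_basis e N = stacking_mx (above mu (n := n)) K.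
Proof.
move=> mu_part /jordan_type_size smu [ue eN e0].
rewrite -(size_boxes mu_part) in smu.
have hD := stacking_above smu.
apply/matrixP => i k; rewrite [RHS]mxE /matrix_in_basis -mulmxA.
have NkE : ((invmx e *m (N *m e)) i k) = (invmx e *m (N *m col k e)) i ord0.
  by rewrite colE !mulmxA -colE [RHS]mxE.
rewrite NkE; have [/existsP[j jk]|] := boolP [exists j, above mu j k].
  rewrite (eN k j jk) colE mulKmx // mxE eqxx andbT; congr (nat_of_bool _)%:R.
  apply/eqP/idP => [-> //|ik]; exact: (stacking_fun hD ik jk).
rewrite negb_exists => /forallP nk; rewrite e0 // mulmx0 mxE.
by rewrite (negbTE (nk i)).
Qed.

(** * Counting the free entries *)

Section Counting.
Variables (mu : seq nat) (n : nat) (h : 'I_n -> 'I_n) (pi : 'S_n).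
Hypothesis size_mu : size (boxes mu) = n.

(** Free pairs (i, j) with no box above j are the top inversions. Otherwise the box k above j is
    unique, so forgetting k is injective on the triples. *)
Lemma card_free_pairs :
  #|free_pairs (above mu (n := n)) h pi| =
    (#|top_inversions mu pi| + #|hessenberg_triples mu h pi|)%N.
Proof.
have hD := stacking_above size_mu.
have rbE (i j : 'I_n) : right_or_below mu i j = (i < j)%N.
  by apply: right_or_belowE; rewrite size_mu.
pose proj (t : 'I_n * 'I_n * 'I_n) : 'I_n * 'I_n := (t.1.1, t.1.2).
have projE : #|(proj @: hessenberg_triples mu h pi)%SET| = #|hessenberg_triples mu h pi|.
  apply: card_in_imset => -[[i j] k] [[i' j'] k']; rewrite !inE.
  move=> /and3P[jk _ _] /and3P[jk' _ _] [ii' jj']; rewrite -ii' -jj' in jk' *.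
  by rewrite (stacking_inj hD jk jk').
rewrite -projE -cardsUI [X in (_ + X)%N](_ : _ = 0%N) ?addn0; last first.
  apply/eqP; rewrite cards_eq0; apply/eqP/setP => -[i j]; rewrite !inE /=.
  apply/negP => /andP[/and3P[_ /forallP nj _] /imsetP[[[i' j'] k]]].
  by rewrite inE => /and3P[jk _ _] [_ jj']; have := nj k; rewrite jj' jk.
apply: eq_card => -[i j]; rewrite !inE /= rbE /free_pair.
apply/and3P/orP => [[ij ltji /forallP hk]|[/and3P[ij /forallP hk ltji]|]].
- have [/existsP[k jk]|] := boolP [exists k, above mu j k].
    right; apply/imsetP; exists (i, j, k) => //; rewrite inE rbE ij ltji.
    by have := hk k; rewrite jk => /= ->; rewrite andbT.
  by rewrite negb_exists => nk; left; rewrite ij ltji andbT.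
- split=> //; apply/forallP => k; have := hk k; rewrite -[directly_above _ _ _]/(above mu j k).
  by move/negbTE ->.
- move=> /imsetP[[[i' j'] k]]; rewrite inE rbE => /and3P[jk ij /andP[ltji le]] [-> ->].
  split=> //; apply/forallP => k'; apply/implyP => jk'.
  by rewrite (stacking_inj hD jk' jk).
Qed.

End Counting.

(** * Morphisms of spaces with functions *)

Section Morphisms.
Variable K : fieldType.

(* A morphism on the open subset W; the values of f outside W are irrelevant. *)
Definition morphism_on (X Y : kspace K) (W : set X) (f : X -> Y) : Prop :=
  (forall U : set Y, zopen U -> zopen (W `&` f @^-1` U)) /\
  (forall (U : set Y) (g : Y -> K), zopen U -> zregular U g ->
     zregular (W `&` f @^-1` U) (g \o f)).

Definition morphism (X Y : kspace K) (f : X -> Y) : Prop := morphism_on setT f.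

Lemma morphism_on_full (X Y : kspace K) (W : set X) (f : X -> Y) :
  (forall x, W x) -> morphism_on W f -> morphism f.
Proof.
move=> hW; suff -> : W = setT by [].
by apply/seteqP; split.
Qed.

Lemma morphism_comp (X Y Z : kspace K) (f : X -> Y) (g : Y -> Z) :
  morphism f -> morphism g -> morphism (g \o f).
Proof.
move=> [fo fr] [go gr]; split=> [U /go|U k oU /(gr _ _ oU)].
  by rewrite setTI => /fo.
by rewrite !setTI => /fr; rewrite setTI; apply; have := go U oU; rewrite setTI.
Qed.

Lemma isomorphic_of_morphisms (X Y : kspace K) (f : X -> Y) (g : Y -> X) :
  morphism f -> morphism g -> cancel f g -> cancel g f -> isomorphic X Y.
Proof.
move=> [fo fr] [go gr] fK gK; exists f.
have fo' U : zopen U -> zopen (f @^-1` U) by move/fo; rewrite setTI.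
have gfE (U : set Y) : g @^-1` (f @^-1` U) = U.
  by apply/seteqP; split=> y; rewrite /= gK.
split=> [|U|U k oU]; first by exists g.
  split=> [/fo' //|/go]; by rewrite setTI gfE.
split=> [/(fr _ _ oU)|/(gr _ _ (fo' _ oU))]; rewrite setTI // gfE.
by congr (zregular _ _); apply/funext => y /=; rewrite gK.
Qed.

(** The gluing property of a sheaf. It is asked of the source of a map into an induced space, where
    regular functions extend to the ambient space only locally. *)
Definition regularity_local (X : kspace K) : Prop :=
  forall (U : set X) (g : X -> K),
    (forall x, U x -> exists (V : set X) (F : X -> K),
      [/\ zopen V, zregular V F, V x & forall y, U y -> V y -> g y = F y]) ->
    zregular U g.

Lemma coord_space_local (T : Type) (d : nat) (x : T -> 'rV[K]_d) :
  regularity_local (coord_space x).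
Proof.
move=> U g hg t Ut; have [V [F [/zopen_coordP[S VS] rF Vt gF]]] := hg t Ut.
have [p [q [qt Fpq]]] := rF t Vt.
(* The extra factor [s] makes the denominator vanish outside [V], where nothing is known about
   [F]. *)
move: (Vt); rewrite VS => -[s Ss st]; exists (p * s), (q * s).
split; first by rewrite mevalM mulf_neq0.
move=> u Uu; rewrite !mevalM mulf_eq0 negb_or => /andP[qu su].
have Vu : V u by rewrite VS; exists s.
by rewrite gF // Fpq // -mulf_div divff // mulr1.
Qed.

Lemma morphism_induced (Y X : kspace K) (A : set X)
    (f : Y -> induced_space A) :
  regularity_local Y -> morphism ((val : induced_space A -> X) \o f) ->
  morphism f.
Proof.
move=> Yloc [fo fr]; split=> [U [V oV ->]|U k oU hk].
  by have := fo _ oV; rewrite !setTI.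
rewrite setTI; apply: Yloc => y Uy.
have [V [F [oV rF Vy kF]]] := hk _ Uy.
pose vf := (val : induced_space A -> X) \o f.
exists (vf @^-1` V), (F \o vf).
have := fo _ oV; have := fr _ _ oV rF; rewrite !setTI => h1 h2; split=> // z Uz Vz.
exact: kF.
Qed.

Lemma morphism_on_induced (X Y : kspace K) (A W : set X) (f : X -> Y) :
  morphism_on W f ->
  morphism_on ((val : induced_space A -> X) @^-1` W) (f \o val).
Proof.
move=> [fo fr]; split=> [U oU|U k oU hk].
  by exists (W `&` f @^-1` U); first exact: fo.
move=> x WUx; exists (W `&` f @^-1` U), (k \o f); split=> //.
- exact: fo.
- exact: fr.
Qed.

Lemma morphism_quotient (X : kspace K) (Y : Type) (q : X -> Y) :
  morphism (q : X -> quotient_space q).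
Proof. by split=> [U|U g oU]; rewrite setTI. Qed.

Lemma morphism_on_quotient (X Z : kspace K) (Y : Type) (q : X -> Y)
    (W : set (quotient_space q)) (f : quotient_space q -> Z) :
  morphism_on (q @^-1` W) (f \o q) -> morphism_on W f.
Proof. by []. Qed.

Lemma morphism_polynomial (T T' : Type) (d d' : nat) (x : T -> 'rV[K]_d)
    (y : T' -> 'rV[K]_d') (f : coord_space x -> coord_space y)
    (P : 'I_d' -> {mpoly K[d]}) :
  (forall t k, y (f t) ord0 k = (P k).@[x t ord0]) -> morphism f.
Proof.
move=> fP; pose lP := [tuple P k | k < d'].
have compE p t : (p \mPo lP).@[x t ord0] = p.@[y (f t) ord0].
  by rewrite comp_mpoly_meval; apply: meval_eq => k; rewrite tnth_mktuple fP.
split=> [U /zopen_coordP[S ->]|U g oU hg]; rewrite setTI.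
  apply/zopen_coordP; exists [set p \mPo lP | p in S].
  apply/seteqP; split=> t /=.
    by move=> [p Sp pt]; exists (p \mPo lP); [exists p | rewrite compE].
  by move=> [_ [p Sp <-]]; rewrite compE; exists p.
move=> t Ut; have [p [q [qt gpq]]] := hg _ Ut.
exists (p \mPo lP), (q \mPo lP); rewrite compE; split=> // u Uu.
by rewrite !compE => qu; rewrite -gpq.
Qed.

Definition fractional (T : Type) (d : nat) (x : T -> 'rV[K]_d) (W : set T)
    (f : T -> K) : Prop :=
  exists p q : {mpoly K[d]}, forall t, W t ->
    q.@[x t ord0] != 0 /\ f t = p.@[x t ord0] / q.@[x t ord0].

Lemma eq_fractional (T : Type) (d : nat) (x : T -> 'rV[K]_d) (W : set T)
    (f g : T -> K) : f =1 g -> fractional x W f -> fractional x W g.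
Proof. by move=> /funext ->. Qed.

Lemma fractional_meval (T : Type) (d d' : nat) (x : T -> 'rV[K]_d) (W : set T)
    (f : T -> 'rV[K]_d') (p : {mpoly K[d']}) :
  (forall k, fractional x W (fun t => f t ord0 k)) ->
  fractional x W (fun t => p.@[f t ord0]).
Proof.
move=> hf.
have fC c : fractional x W (fun=> c).
  by exists c%:MP, 1 => t _; rewrite meval1 mevalC divr1 oner_eq0.
have fD f1 f2 : fractional x W f1 -> fractional x W f2 ->
    fractional x W (fun t => f1 t + f2 t).
  move=> [p1 [q1 h1]] [p2 [q2 h2]]; exists (p1 * q2 + p2 * q1), (q1 * q2) => t Wt.
  have [q1t ->] := h1 t Wt; have [q2t ->] := h2 t Wt.
  by rewrite mevalD !mevalM mulf_neq0 // addf_div.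
have fM f1 f2 : fractional x W f1 -> fractional x W f2 ->
    fractional x W (fun t => f1 t * f2 t).
  move=> [p1 [q1 h1]] [p2 [q2 h2]]; exists (p1 * p2), (q1 * q2) => t Wt.
  have [q1t ->] := h1 t Wt; have [q2t ->] := h2 t Wt.
  by rewrite !mevalM mulf_neq0 // mulf_div.
have fX f1 e : fractional x W f1 -> fractional x W (fun t => f1 t ^+ e).
  move=> h1; elim: e => [|e IHe]; first exact: fC.
  by apply: eq_fractional (fM _ _ h1 IHe) => t; rewrite exprS.
have fprod (m : 'X_{1..d'}) (s : seq 'I_d') :
    fractional x W (fun t => \prod_(i <- s) f t ord0 i ^+ m i).
  elim: s => [|i s IHs].
    by apply: eq_fractional (fC 1) => t; rewrite big_nil.
  apply: eq_fractional (fM _ _ (fX _ (m i) (hf i)) IHs) => t.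
  by rewrite big_cons.
have fsum (s : seq 'X_{1..d'}) : fractional x W
    (fun t => \sum_(m <- s) p@_m * \prod_(i < d') f t ord0 i ^+ m i).
  elim: s => [|m s IHs].
    by apply: eq_fractional (fC 0) => t; rewrite big_nil.
  apply: eq_fractional (fD _ _ (fM _ _ (fC p@_m) (fprod m _)) IHs) => t.
  by rewrite big_cons.
by apply: eq_fractional (fsum (msupp p)) => t; rewrite mevalE.
Qed.

Lemma morphism_on_fractional (T T' : Type) (d d' : nat) (x : T -> 'rV[K]_d)
    (y : T' -> 'rV[K]_d') (W : set (coord_space x))
    (f : coord_space x -> coord_space y) :
  zopen W ->
  (forall k, fractional x W (fun t => y (f t) ord0 k)) -> morphism_on W f.
Proof.
move=> /zopen_coordP[SW WS] hf.
have hp (p : {mpoly K[d']}) : fractional x W (fun t => p.@[y (f t) ord0]).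
  exact: (@fractional_meval _ _ _ x W (y \o f)).
split=> [U /zopen_coordP[S ->]|U g oU hg].
  (* [s] ranges over the polynomials cutting out the complement of [W], and [a] over numerators of
     the pulled-back [p]; [s * a] is nonzero only at points of [W] where [p] is nonzero at the
     image. *)
  apply/zopen_coordP; exists [set r | exists s p a, [/\ SW s, S p, r = s * a &
    exists b, forall t, W t -> b.@[x t ord0] != 0 /\
      p.@[y (f t) ord0] = a.@[x t ord0] / b.@[x t ord0]]].
  apply/seteqP; split=> t /=.
    move=> [Wt [p Sp pt]]; have [a [b hab]] := hp p.
    have [s Ss st] : exists2 s, SW s & s.@[x t ord0] != 0 by move: Wt; rewrite WS.
    exists (s * a); first by exists s, p, a; split=> //; exists b.
    have [bt pE] := hab t Wt; rewrite mevalM mulf_neq0 //.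
    by apply: contra_neq pt => a0; rewrite pE a0 mul0r.
  move=> [_ [s [p [a [Ss Sp -> [b hab]]]]]].
  rewrite mevalM mulf_eq0 negb_or => /andP[st at0].
  have Wt : W t by rewrite WS; exists s.
  split=> //; exists p => //; have [bt ->] := hab t Wt.
  by rewrite mulf_neq0 // invr_eq0.
move=> t [Wt Ut]; have [p [q [qt gpq]]] := hg _ Ut.
have [a [b hab]] := hp p; have [a' [b' hab']] := hp q.
exists (a * b'), (b * a').
have [bt pE] := hab t Wt; have [b't qE] := hab' t Wt.
split.
  rewrite mevalM mulf_neq0 //.
  by apply: contra_neq qt => a'0; rewrite qE a'0 mul0r.
move=> u [Wu Uu]; rewrite !mevalM mulf_eq0 negb_or => /andP[bu a'u].
have [_ pEu] := hab u Wu; have [b'u qEu] := hab' u Wu.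
rewrite /= gpq //; last by rewrite qEu mulf_neq0 // invr_eq0.
by rewrite pEu qEu invf_div mulf_div.
Qed.

End Morphisms.

(** * Hessenberg cells *)

Lemma invmx_mul (R : comUnitRingType) n (A B : 'M[R]_n) :
  A \in unitmx -> B \in unitmx -> invmx (A *m B) = invmx B *m invmx A.
Proof.
move=> uA uB; have uAB : A *m B \in unitmx by rewrite unitmx_mul uA.
by rewrite -[RHS](mulmxK uAB) mulmxA mulmxKV // mulVmx // mul1mx.
Qed.

Definition set_point (T : Type) (A : set T) (x : T) (Ax : A x) : set_type A :=
  exist (fun y => y \in A) x (mem_set Ax).

(** * Schubert cells and charts of the flag variety *)

Section FlagVariety.
Variables (K : fieldType) (n : nat).
Implicit Types (pi sigma : 'S_n) (u b : 'M[K]_n) (g : GL K n).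

Definition to_GL (A : 'M[K]_n) (uA : A \in unitmx) : GL K n :=
  @set_point (matrix_space K n n) [set A | (A : 'M[K]_n) \in unitmx] A uA.

Lemma GLmx_unit g : GLmx g \in unitmx.
Proof. exact: set_mem (valP g). Qed.

Lemma GLmxK A (uA : A \in unitmx) : GLmx (to_GL uA) = A.
Proof. by []. Qed.

Lemma eq_to_flag g g' :
  to_flag g = to_flag g' <->
  exists b, [/\ b \in unitmx, upper_triangular b & GLmx g' = GLmx g *m b].
Proof.
split=> [/(congr1 val)/= gg'|[b [ub hb gb]]].
  have : Borel_coset g' g'.
    exists (to_GL (unitmx1 K n)); first exact: upper_triangular1.
    by rewrite GLmxK mulmx1.
  by rewrite -gg' => -[b hb gb]; exists (GLmx b); split=> //; apply: GLmx_unit.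
apply: val_inj => /=; apply/seteqP; split=> x [c hc xc].
  have uc : invmx b *m GLmx c \in unitmx by rewrite unitmx_mul unitmx_inv ub GLmx_unit.
  exists (to_GL uc).
    exact: upper_triangularM (upper_triangular_inv ub hb) hc.
  by rewrite GLmxK gb mulmxA mulmxK.
have uc : b *m GLmx c \in unitmx by rewrite unitmx_mul ub GLmx_unit.
exists (to_GL uc); first exact: upper_triangularM hb hc.
by rewrite GLmxK xc gb mulmxA.
Qed.

Lemma to_flag_surj (x : flag_variety K n) : exists g, to_flag g = x.
Proof.
have [g _ gx] := set_mem (valP x).
by exists g; apply: val_inj.
Qed.

Definition flag_repr (x : flag_variety K n) : GL K n := sval (cid (to_flag_surj x)).

Lemma flag_reprK x : to_flag (flag_repr x) = x.
Proof. exact: (svalP (cid (to_flag_surj x))). Qed.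

Lemma row_permM pi (A B : 'M[K]_n) : row_perm pi (A *m B) = row_perm pi A *m B.
Proof. by apply/matrixP => i j; rewrite !mxE; apply: eq_bigr => k _; rewrite mxE. Qed.

Lemma minor_upper_neq0 b (i : 'I_n) :
  b \in unitmx -> upper_triangular b -> minor i i b != 0.
Proof.
move=> ub hb; have := @minor_conjugate_neq0 _ _ b 1%g i hb ub.
congr (minor i i _ != 0); rewrite row_perm_permutation.
by apply/matrixP => r c; rewrite mxE !perm1.
Qed.

Lemma minor_mulmx_upper pi (i j : 'I_n) (A b : 'M[K]_n) : upper_triangular b ->
  minor i j (row_perm pi (A *m b)) = minor i j (row_perm pi A) * minor j j b.
Proof. by move=> /upper_triangularP hb; rewrite row_permM minor_mulmx. Qed.

(** [row_perm pi A] is the product of the inverse permutation matrix of [pi] with [A]. *)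
Definition lead_minors pi (A : 'M[K]_n) : K :=
  \prod_i minor i i (row_perm pi A).

Lemma lead_minors_neq0P pi A :
  reflect (forall i, minor i i (row_perm pi A) != 0) (lead_minors pi A != 0).
Proof.
rewrite prodf_seq_neq0; apply: (iffP allP) => h i; last by move=> _; apply: h.
by apply: h; rewrite mem_index_enum.
Qed.

Lemma lead_minors_mulmx pi A b : b \in unitmx -> upper_triangular b ->
  (lead_minors pi (A *m b) != 0) = (lead_minors pi A != 0).
Proof.
move=> ub hb.
have E i : (minor i i (row_perm pi (A *m b)) != 0) = (minor i i (row_perm pi A) != 0).
  by rewrite minor_mulmx_upper // mulf_eq0 negb_or (minor_upper_neq0 i ub hb) andbT.
by apply/lead_minors_neq0P/lead_minors_neq0P => h i; have := h i; rewrite E.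
Qed.

Definition chart_domain pi : set (flag_variety K n) :=
  [set x | lead_minors pi (GLmx (flag_repr x)) != 0].

Lemma chart_domain_to_flag pi g :
  chart_domain pi (to_flag g) <-> lead_minors pi (GLmx g) != 0.
Proof.
have /eq_to_flag[b [ub hb ->]] := flag_reprK (to_flag g).
by rewrite lead_minors_mulmx.
Qed.

Lemma schubert_cell_lead_minors pi (x : flag_variety K n) :
  schubert_cell pi x -> chart_domain pi x.
Proof.
move=> [g [b1 [b2 [hb1 hb2 gE]]] <-]; apply/chart_domain_to_flag.
rewrite gE lead_minors_mulmx ?GLmx_unit //; apply/lead_minors_neq0P => i.
by apply: minor_conjugate_neq0 => //; apply: GLmx_unit.
Qed.

Lemma lead_minors_partial_sum pi u b sigma g :
  upper_triangular u -> b \in unitmx -> upper_triangular b ->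
  GLmx g *m b = u *m permutation_matrix K sigma ->
  lead_minors pi (GLmx g) != 0 ->
  forall i, (partial_sum pi i <= partial_sum sigma i)%N.
Proof.
move=> hu ub hb gE; rewrite -(lead_minors_mulmx pi _ ub hb) gE.
by move=> /lead_minors_neq0P h i; apply: minor_permuted_partial_sum (h i).
Qed.

Lemma chart_domain_partial_sum pi sigma (x : flag_variety K n) :
  chart_domain pi x -> schubert_cell sigma x ->
  forall i, (partial_sum pi i <= partial_sum sigma i)%N.
Proof.
move=> /[swap] -[g [b1 [b2 [hb1 hb2 gE]]] <-] /chart_domain_to_flag.
apply: (lead_minors_partial_sum (b := invmx (GLmx b2))) hb1 _ _ _.
- by rewrite unitmx_inv GLmx_unit.
- exact: upper_triangular_inv (GLmx_unit _) hb2.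
- by rewrite gE mulmxK ?GLmx_unit.
Qed.

(** Each cell lies in its own chart, so a common point gives inequalities between the partial sums
    in both directions. *)
Lemma schubert_cell_disjoint pi sigma (x : flag_variety K n) :
  schubert_cell pi x -> schubert_cell sigma x -> pi = sigma.
Proof.
move=> hpi hsigma; apply: partial_sum_inj => b; apply/eqP; rewrite eqn_leq.
rewrite (chart_domain_partial_sum (schubert_cell_lead_minors hpi) hsigma).
by rewrite (chart_domain_partial_sum (schubert_cell_lead_minors hsigma) hpi).
Qed.

Lemma cell_form_schubert pi u (uu : u *m permutation_matrix K pi \in unitmx) :
  cell_form pi u -> schubert_cell pi (to_flag (to_GL uu)).
Proof.
move=> hu; exists (to_GL uu) => //.
exists (to_GL (cell_form_unitmx hu)), (to_GL (unitmx1 K n)); split.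
- exact: cell_form_upper hu.
- exact: upper_triangular1.
- by rewrite !GLmxK mulmx1.
Qed.

Lemma flag_cell_form (x : flag_variety K n) :
  exists pi u (uu : u *m permutation_matrix K pi \in unitmx),
    cell_form pi u /\ x = to_flag (to_GL uu).
Proof.
have [g <-] := to_flag_surj x.
have [pi [u [b [hu ub hb gb]]]] := echelon_form (GLmx_unit g).
have uu : u *m permutation_matrix K pi \in unitmx.
  by rewrite -gb unitmx_mul GLmx_unit.
by exists pi, u, uu; split=> //; apply/eq_to_flag; exists b.
Qed.

Lemma schubert_cell_form pi (x : flag_variety K n) : schubert_cell pi x ->
  exists u (uu : u *m permutation_matrix K pi \in unitmx),
    cell_form pi u /\ x = to_flag (to_GL uu).
Proof.
move=> hx; have [sigma [u [uu [hu xE]]]] := flag_cell_form x.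
have hs := cell_form_schubert uu hu; rewrite -xE in hs.
have e := schubert_cell_disjoint hx hs; subst sigma.
by exists u, uu.
Qed.

Definition generic_matrix : 'M[{mpoly K[n * n]}]_n :=
  \matrix_(i, j) 'X_(mxvec_index i j).

Definition minor_poly pi (i j : 'I_n) : {mpoly K[n * n]} :=
  minor i j (row_perm pi generic_matrix).

Lemma minor_polyE pi i j (A : 'M[K]_n) :
  (minor_poly pi i j).@[mxvec A ord0] = minor i j (row_perm pi A).
Proof.
rewrite -minor_map; congr minor; apply/matrixP => r c.
by rewrite !mxE /= mevalXU mxvecE.
Qed.

Lemma lead_minors_polyE pi (A : 'M[K]_n) :
  (\prod_i minor_poly pi i i).@[mxvec A ord0] = lead_minors pi A.
Proof. by rewrite rmorph_prod; apply: eq_bigr => i _; rewrite /= minor_polyE. Qed.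

Lemma zopen_lead_minors (P : set 'S_n) :
  zopen ([set A | exists2 pi, P pi & lead_minors pi A != 0] :
    set (matrix_space K n n)).
Proof.
apply/zopen_coordP; exists [set \prod_i minor_poly pi i i | pi in P].
apply/seteqP; split=> A /=.
  move=> [pi Ppi hA]; exists (\prod_i minor_poly pi i i); first by exists pi.
  by rewrite lead_minors_polyE.
by move=> [_ [pi Ppi <-]]; rewrite lead_minors_polyE; exists pi.
Qed.

Lemma zopen_chart_domain (P : set 'S_n) :
  zopen [set x : flag_variety K n | exists2 pi, P pi & chart_domain pi x].
Proof.
exists [set A | exists2 pi, P pi & lead_minors pi A != 0].
  exact: zopen_lead_minors.
by apply/seteqP; split=> g /= [pi Ppi hg]; exists pi => //; apply/chart_domain_to_flag.
Qed.

(* The lower triangular factor of pi^-1 A. *)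
Definition chart_coord pi (p : 'I_n * 'I_n) (A : 'M[K]_n) : K :=
  minor (filling pi p.1) (filling pi p.2) (row_perm pi A) /
  minor (filling pi p.2) (filling pi p.2) (row_perm pi A).

Lemma chart_coord_mulmx pi p A b : b \in unitmx -> upper_triangular b ->
  chart_coord pi p (A *m b) = chart_coord pi p A.
Proof.
move=> ub hb; rewrite /chart_coord !minor_mulmx_upper //.
by rewrite -mulf_div divff ?mulr1 // minor_upper_neq0.
Qed.

(** Conjugating a cell form [u] by [pi] gives a unipotent lower triangular matrix, to which
    [minor_lower] applies. *)
Lemma chart_coord_cell_form pi u (p : 'I_n * 'I_n) : cell_form pi u ->
  chart_coord pi p (u *m permutation_matrix K pi) = u p.1 p.2.
Proof.
move=> hu; rewrite /chart_coord row_perm_permutation.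
set L := \matrix_(i, j) _.
have L0 (i j : 'I_n) : (i < j)%N -> L i j = 0.
  move=> ij; rewrite mxE; case: (hu (pi i) (pi j)) => [->|[_]].
    by rewrite (inj_eq perm_inj) -val_eqE ltn_eqF.
  by rewrite /filling !permK ltnNge (ltnW ij).
have L1 i : L i i = 1 by rewrite mxE (cell_form_diag _ hu).
by rewrite !minor_lower // L1 divr1 mxE /filling !permKV.
Qed.

Lemma fractional_chart_coord pi p :
  fractional (@mxvec K n n) [set A | lead_minors pi A != 0] (chart_coord pi p).
Proof.
exists (minor_poly pi (filling pi p.1) (filling pi p.2)).
exists (minor_poly pi (filling pi p.2) (filling pi p.2)) => A /= hA.
by rewrite !minor_polyE; split=> //; apply: (lead_minors_neq0P _ _ hA).
Qed.

End FlagVariety.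

Section Cells.
Variables (K : fieldType) (n : nat) (D : rel 'I_n) (h : 'I_n -> 'I_n).
Variables (H : {vspace 'M[K]_n}) (pi : 'S_n).
Hypotheses (HD : stacking D) (H_hess : hessenberg_space H).
Hypothesis Hh : corresponding_function H h.
Local Notation N := (stacking_mx D K).
Local Notation tau := (filling pi).

Lemma hessenberg_set_to_flag g :
  hessenberg_set N H (to_flag g) <-> invmx (GLmx g) *m N *m GLmx g \in H.
Proof.
split=> [[g' hg' /eq_to_flag[b [ub hb ->]]]|hg]; last by exists g.
rewrite invmx_mul ?GLmx_unit //.
rewrite -[X in X \in H](_ : invmx b *m (invmx (GLmx g') *m N *m GLmx g') *m b = _).
  exact: (hessenberg_space_conj H_hess Hh) (upper_triangular_inv ub hb) hb hg'.
by rewrite !mulmxA.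
Qed.

(** With g = u pi and c = u^-1 N u, the matrix g^-1 N g has entry [c (pi i) (pi j)] at (i, j), so
    membership in [H] becomes a zero pattern for [c]. *)
Lemma hessenberg_cell_form u (uu : u *m permutation_matrix K pi \in unitmx) :
  cell_form pi u ->
  hessenberg_set N H (to_flag (to_GL uu)) <->
  exists2 c, N *m u = u *m c &
    forall i k : 'I_n, (h (tau k) < tau i)%N -> c i k = 0.
Proof.
move=> hu; have uu' := cell_form_unitmx hu.
have P_unit := permutation_matrix_unitmx K pi.
rewrite hessenberg_set_to_flag GLmxK (mem_hessenberg_space H_hess Hh).
have conjE c : N *m u = u *m c ->
    invmx (u *m permutation_matrix K pi) *m N *m (u *m permutation_matrix K pi) =
    \matrix_(i, j) c (pi i) (pi j).
  move=> uc; rewrite -mulmxA [N *m _]mulmxA uc invmx_mul // -mulmxA.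
  rewrite -[u *m c *m _]mulmxA mulKmx //.
  rewrite -[RHS](mulKmx P_unit); congr (_ *m _).
  rewrite mulmx_permutation; apply/matrixP => i j; rewrite !mxE.
  rewrite (bigD1 ((pi^-1)%g i)) //= !mxE permKV eqxx mul1r big1 ?addr0 // => k ki.
  rewrite !mxE (_ : (i == pi k) = false) ?mul0r //.
  by apply: contraNF ki => /eqP ->; rewrite permK.
split=> [hc|[c uc hc] i j hji].
  exists (invmx u *m (N *m u)); first by rewrite mulKVmx.
  move=> i k hik; have := hc _ _ hik.
  rewrite (conjE (invmx u *m (N *m u))) ?mulKVmx //.
  by rewrite mxE /filling !permKV.
by rewrite (conjE c uc) mxE hc // /filling !permK.
Qed.

Local Notation d := #|free_pairs D h pi|.

Definition free_entries (A : comNzRingType) (t : 'rV[A]_d) : 'M[A]_n :=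
  \matrix_(i, j) \sum_k (enum_val k == (i, j))%:R * t ord0 k.

Lemma free_entries_val (A : comNzRingType) (t : 'rV[A]_d) k :
  free_entries t (enum_val k).1 (enum_val k).2 = t ord0 k.
Proof.
rewrite mxE (bigD1 k) //= -surjective_pairing eqxx mul1r big1 ?addr0 // => l lk.
by rewrite (inj_eq enum_val_inj) (negbTE lk) mul0r.
Qed.

Definition cell_matrix (A : comNzRingType) (t : 'rV[A]_d) : 'M[A]_n :=
  param D h pi (free_entries t).

Lemma cell_matrix_unit (t : 'rV[K]_d) :
  cell_matrix t *m permutation_matrix K pi \in unitmx.
Proof.
rewrite unitmx_mul permutation_matrix_unitmx andbT.
exact: (cell_form_unitmx (param_cell_form h pi HD _)).
Qed.

Definition cell_coords (A : 'M[K]_n) : 'rV[K]_d :=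
  \row_k chart_coord pi (enum_val k) A.

Lemma cell_coords_matrix (t : 'rV[K]_d) :
  cell_coords (cell_matrix t *m permutation_matrix K pi) = t.
Proof.
apply/rowP => k; rewrite mxE chart_coord_cell_form; last exact: param_cell_form.
rewrite /cell_matrix param_free ?free_entries_val //.
by have := enum_valP k; rewrite inE.
Qed.

Lemma cell_matrix_coords u :
  cell_form pi u ->
  (exists2 c, N *m u = u *m c &
    forall i k : 'I_n, (h (tau k) < tau i)%N -> c i k = 0) ->
  cell_matrix (cell_coords (u *m permutation_matrix K pi)) = u.
Proof.
move=> hu [c uc hc]; rewrite [RHS](equation_param HD hu uc hc).
apply: eq_param => // i j fij.
have fp : (i, j) \in free_pairs D h pi by rewrite inE.
have := free_entries_val (cell_coords (u *m permutation_matrix K pi))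
  (enum_rank_in fp (i, j)).
rewrite [X in _ = X]mxE (enum_rankK_in fp fp) => ->.
by rewrite chart_coord_cell_form.
Qed.

(** [P] comes from [cell_matrix] at the generic point, whose coordinates are the variables of the
    polynomial ring. *)
Lemma cell_matrix_polynomial :
  exists P : 'I_n -> 'I_n -> {mpoly K[d]}, forall (t : 'rV[K]_d) i j,
    (cell_matrix t *m permutation_matrix K pi) i j = (P i j).@[t ord0].
Proof.
pose X : 'rV[{mpoly K[d]}]_d := \row_k 'X_k.
exists (fun i j => cell_matrix X i (pi j)) => t i j.
rewrite mulmx_permutation mxE.
have -> : cell_matrix t = map_mx (meval (t ord0)) (cell_matrix X).
  rewrite /cell_matrix map_param //; congr param; apply/matrixP => r c.
  rewrite !mxE rmorph_sum; apply: eq_bigr => k _.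
  by rewrite rmorphM rmorph_nat mxE /= mevalXU.
by rewrite mxE.
Qed.

Local Notation cell := (hessenberg_cell N H pi).

Lemma hessenberg_cell_admissible :
  cell !=set0 <-> forall j k : 'I_n, D j k -> (tau j <= h (tau k))%N.
Proof.
split=> [[x cx]|hadm].
  have [u [uu [hu xE]]] := schubert_cell_form cx.
  have hx := set_mem (valP x); rewrite xE in hx.
  have [c uc hc] := (hessenberg_cell_form uu hu).1 hx.
  exact: (equation_admissible HD hu uc hc).
have hu := param_cell_form h pi HD (0 : 'M[K]_n).
have uu : param D h pi 0 *m permutation_matrix K pi \in unitmx.
  by rewrite unitmx_mul (cell_form_unitmx hu) permutation_matrix_unitmx.
have hx := (hessenberg_cell_form uu hu).2 (param_equation HD _ hadm).
by exists (set_point hx); apply: cell_form_schubert.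
Qed.

(** [phi] sends free entries to the flag of the corresponding [u]; its inverse [psi] recovers them
    as ratios of minors. These ratios are invariant under right multiplication by the Borel
    subgroup, hence functions of the flag. *)
Lemma isomorphic_hessenberg_cell :
  (forall j k : 'I_n, D j k -> (tau j <= h (tau k))%N) ->
  isomorphic (affine_space K d) (induced_space cell).
Proof.
move=> hadm.
pose gt (t : affine_space K d) : GL K n := to_GL (cell_matrix_unit t).
have hu (t : 'rV[K]_d) : cell_form pi (cell_matrix t) by exact: param_cell_form.
have hx t : hessenberg_set N H (to_flag (gt t)).
  exact: (hessenberg_cell_form _ (hu t)).2 (param_equation HD _ hadm).
pose x1 t : hessenberg_variety N H := set_point (hx t).
have hc t : cell (x1 t) by exact: cell_form_schubert.
pose phi (t : affine_space K d) : induced_space cell := set_point (hc t).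
pose psi0 (A : matrix_space K n n) : affine_space K d := cell_coords A.
pose psi1 (x : flag_variety K n) : affine_space K d := psi0 (GLmx (flag_repr x)).
pose psi (x : induced_space cell) : affine_space K d := psi1 (val (val x)).
have psi1E g : psi1 (to_flag g) = psi0 (GLmx g).
  have /eq_to_flag[b [ub hb ->]] := flag_reprK (to_flag g).
  by apply/rowP => k; rewrite !mxE chart_coord_mulmx.
apply: (@isomorphic_of_morphisms _ _ _ phi psi).
- have Aloc := @coord_space_local K _ d id.
  apply: (morphism_induced Aloc); apply: (morphism_induced Aloc).
  apply: (@morphism_comp K (affine_space K d) (GL K n) (flag_variety K n) gt
    (@to_flag K n)); last exact: morphism_quotient.
  apply: (morphism_induced Aloc).
  have [P hP] := cell_matrix_polynomial.
  apply: (@morphism_polynomial _ _ _ _ _ id (@mxvec K n n) _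
    (fun k => mxvec (\matrix_(i, j) P i j) ord0 k)) => t k.
  by case/mxvec_indexP: k => i j; rewrite !mxvecE mxE -hP.
(* Regularity is shown on the whole open chart first and then restricted to the cell inside it. *)
- have dom : morphism_on (chart_domain (K := K) pi) psi1.
    apply: morphism_on_quotient.
    have e1 : (@to_flag K n) @^-1` chart_domain pi =
        (val : GL K n -> matrix_space K n n) @^-1` [set A | lead_minors pi A != 0].
      by apply/seteqP; split=> g /= /chart_domain_to_flag.
    have e2 : psi1 \o @to_flag K n = psi0 \o (val : GL K n -> matrix_space K n n).
      by apply/funext => g /=; rewrite psi1E.
    rewrite e1 e2; apply: morphism_on_induced.
    apply: morphism_on_fractional.
      have := @zopen_lead_minors K n [set pi]; congr zopen.
      by apply/seteqP; split=> A /=; [move=> [_ ->] | exists pi].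
    move=> k; have := fractional_chart_coord K pi (enum_val k).
    by apply: eq_fractional => A; rewrite /= mxE.
  have /(morphism_on_induced cell) :=
    morphism_on_induced (hessenberg_set N H) dom.
  apply: morphism_on_full => x /=.
  by apply: schubert_cell_lead_minors; apply: set_mem (valP x).
- by move=> t; rewrite /psi /= psi1E; apply: cell_coords_matrix.
- move=> x; apply: val_inj; apply: val_inj.
  change (to_flag (gt (psi x)) = val (val x)).
  have [u [uu [hu' xE]]] := schubert_cell_form (set_mem (valP x)).
  have hx' := set_mem (valP (val x)); rewrite xE in hx'.
  have := cell_matrix_coords hu' ((hessenberg_cell_form uu hu').1 hx') => uE.
  have -> : psi x = psi0 (GLmx (to_GL uu)) by rewrite /psi xE psi1E.
  by rewrite xE; congr (to_flag _); apply: val_inj; rewrite /= uE.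
Qed.

End Cells.

(** * The paving *)

Section Paving.
Variables (K : fieldType) (n : nat) (N : 'M[K]_n) (H : {vspace 'M[K]_n}).

(** Merges the inequalities between partial sums into a single number by which cells can be
    sorted. *)
Definition score (pi : 'S_n) : nat := \sum_b partial_sum pi b.

(* Hence a union of cells that is final in a list sorted by score is a union of
   chart domains, which is open. *)
Lemma chart_domain_score (pi sigma : 'S_n) (x : flag_variety K n) :
  chart_domain pi x -> schubert_cell sigma x -> pi = sigma \/ (score pi < score sigma)%N.
Proof.
move=> cx sx; have le := chart_domain_partial_sum cx sx.
have [e|ne] := pselect (forall b, partial_sum pi b = partial_sum sigma b).
  by left; apply: partial_sum_inj.
right; have /existsNP[b /eqP neb] := ne.
rewrite /score (bigD1 b) // [X in (_ < X)%N](bigD1 b) //= -addSn.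
by apply: leq_add; [rewrite ltn_neqAle neb le | apply: leq_sum].
Qed.

Variable s : seq 'S_n.
Hypotheses (s_uniq : uniq s) (s_sorted : sorted (relpre score leq) s).
Hypothesis s_cells : forall pi, pi \in s <-> hessenberg_cell N H pi !=set0.
Local Notation cells := [seq hessenberg_cell N H pi | pi <- s].

Lemma nth_cell i : (i < size s)%N ->
  nth set0 cells i = hessenberg_cell N H (nth 1%g s i).
Proof. by move=> lis; rewrite (nth_map 1%g). Qed.

Lemma mem_cell (x : hessenberg_variety N H) :
  exists2 i, (i < size s)%N & schubert_cell (nth 1%g s i) (val x).
Proof.
have [pi [u [uu [hu xE]]]] := flag_cell_form (val x).
have cx : hessenberg_cell N H pi x.
  by rewrite /hessenberg_cell /= xE; apply: cell_form_schubert.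
have spi : pi \in s by apply/s_cells; exists x.
by exists (index pi s); rewrite ?index_mem // nth_index.
Qed.

Lemma cell_index_inj i j (x : hessenberg_variety N H) :
  (i < size s)%N -> (j < size s)%N -> schubert_cell (nth 1%g s i) (val x) ->
  schubert_cell (nth 1%g s j) (val x) -> i = j.
Proof.
move=> si sj hi hj; apply/eqP; rewrite -(nth_uniq 1%g si sj s_uniq); apply/eqP.
exact: schubert_cell_disjoint hi hj.
Qed.

Lemma zclosed_initial_cells i : (i <= size s)%N ->
  zclosed (\bigcup_(k < i) nth set0 cells k).
Proof.
move=> lis; pose tail := [set pi | exists2 k, (i <= k < size s)%N & pi = nth 1%g s k].
(* The complement is claimed to be the union of the charts of the cells from index [i] on: each such
   cell lies in its chart, and these charts miss the earlier cells, whose scores are no larger. *)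
exists [set x | exists2 pi, tail pi & chart_domain pi x].
  exact: zopen_chart_domain.
apply/seteqP; split=> x /=.
  move=> nx; have [k ks kx] := mem_cell x.
  exists (nth 1%g s k); last exact: schubert_cell_lead_minors.
  exists k => //; rewrite ks andbT leqNgt; apply/negP => ki.
  by apply: nx; exists k => //; rewrite nth_cell.
move=> [_ [k /andP[ik ks] ->] cx] [l /= li].
have ls := leq_trans li lis; rewrite nth_cell // => lx.
have lk := leq_trans li ik.
have [/eqP|] := chart_domain_score cx lx.
  by rewrite nth_uniq // gtn_eqF.
rewrite ltnNge => /negP; apply.
apply: (sorted_leq_nth _ _ 1%g s_sorted) => //; last exact: ltnW.
- by move=> a b c; apply: leq_trans.
- by move=> a; apply: leqnn.
Qed.

Lemma paving_hessenberg_cells : paving cells.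
Proof.
split=> [x|i j|i|i].
- have [i si ix] := mem_cell x.
  by exists i; rewrite ?size_map // nth_cell.
- rewrite size_map => /andP[ij js]; have si := ltn_trans ij js.
  rewrite !nth_cell //; apply/seteqP; split=> // x [/= ix jx].
  by have := cell_index_inj si js ix jx => e; move: ij; rewrite e ltnn.
- rewrite size_map => si.
  (* A cell is the difference of two consecutive closed initial unions. *)
  exists (~` \bigcup_(k < i) nth set0 cells k), (\bigcup_(k < i.+1) nth set0 cells k).
  split; [exact: zclosed_initial_cells (ltnW si)|exact: zclosed_initial_cells|].
  apply/seteqP; split=> x /=.
    move=> ix; split; last by exists i => //=.
    move=> [k /= ki]; have sk := ltn_trans ki si.
    rewrite !nth_cell // in ix * => kx.
    by have := cell_index_inj sk si kx ix => e; move: ki; rewrite e ltnn.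
  move=> [nx [k /=]]; rewrite ltnS leq_eqVlt => /orP[/eqP -> //|ki kx].
  by case: nx; exists k.
- by rewrite size_map; apply: zclosed_initial_cells.
Qed.

End Paving.

Theorem theorem24 (R : realType) (n : nat) (N : 'M[R[i]]_n) (mu : seq nat)
    (e : 'M[R[i]]_n) (H : {vspace 'M[R[i]]_n}) (h : 'I_n -> 'I_n)
    (N_nilpotent : exists m : nat, N ^+ m = 0)
    (mu_partition : is_partition mu)
    (N_type : jordan_type N mu)
    (e_basis : young_basis N mu e)
    (H_hessenberg : hessenberg_space H)
    (h_function : corresponding_function H h) :
  let NE := matrix_in_basis e N in
  [/\ exists s : seq 'S_n,
        [/\ uniq s,
            forall pi : 'S_n, pi \in s <-> hessenberg_cell NE H pi !=set0 &
            paving_by_affines [seq hessenberg_cell NE H pi | pi <- s]],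
      forall pi : 'S_n,
        hessenberg_cell NE H pi !=set0 <-> admissible mu h pi &
      forall pi : 'S_n, hessenberg_cell NE H pi !=set0 ->
        has_dimension (induced_space (hessenberg_cell NE H pi))
          (#|top_inversions mu pi| + #|hessenberg_triples mu h pi|)%N].
Proof.
have mu_size : size (boxes mu) = n by rewrite size_boxes ?(jordan_type_size N_type).
rewrite (matrix_in_young_basis mu_partition N_type e_basis) /=.
set NE := stacking_mx _ _.
have HD := stacking_above mu_size.
have cellP pi : hessenberg_cell NE H pi !=set0 <-> admissible mu h pi.
  rewrite (hessenberg_cell_admissible pi HD H_hessenberg h_function).
  by split=> hadm j k; apply: hadm.
have cell_iso pi : hessenberg_cell NE H pi !=set0 ->
    isomorphic (affine_space R[i] #|free_pairs (above mu (n := n)) h pi|)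
      (induced_space (hessenberg_cell NE H pi)).
  move=> /(hessenberg_cell_admissible pi HD H_hessenberg h_function).
  exact: isomorphic_hessenberg_cell.
split=> // [|pi /cell_iso]; last first.
  (* The dimension is that of the affine space with one coordinate for each free pair. *)
  rewrite -card_free_pairs // => /has_dimension_isomorphic; apply.
  exact: dimension_affine_space.
pose s := sort (relpre (@score n) leq) [seq pi <- enum {: 'S_n} | `[<admissible mu h pi>]].
have mem_s pi : pi \in s <-> hessenberg_cell NE H pi !=set0.
  rewrite cellP mem_sort mem_filter mem_enum andbT.
  by split=> [/asboolP|/asboolP].
exists s; split=> //; first by rewrite sort_uniq filter_uniq ?enum_uniq.
split.
  apply: paving_hessenberg_cells => //.
  - by rewrite sort_uniq filter_uniq ?enum_uniq.
  - by apply: sort_sorted => pi sigma; apply: leq_total.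
move=> i; rewrite size_map => si; rewrite (nth_map 1%g) //.
by exists #|free_pairs (above mu (n := n)) h (nth 1%g s i)|; apply/cell_iso/mem_s/mem_nth.
Qed.
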